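(* Consider the first-order quasi-linear system $E^{A}:=\mathfrak{N}^{Aa}_{~\alpha}(x,\phi)\nabla_a\phi^{\alpha}-J^{A}(x,\phi)=0$ and suppose that the following hold. (i) For each $\kappa=(x,\phi)\in b$, $\mathfrak{N}^{A0}_{~\beta}$ has maximal rank, i.e. there is no $\delta\phi^{\beta}\neq 0$ with $\mathfrak{N}^{A0}_{~\beta}\delta\phi^{\beta}=0$. (ii) All constraints of the system come from Geroch fields, i.e. they are $\psi^{\Gamma}:=C^{\Gamma 0}_{A}E^{A}$, $\Gamma=1,\dots,c=e-u$, where the fields $C^{\Gamma a}_{A}(x,\phi)$ satisfy $C^{\Gamma(a}_{A}\mathfrak{N}^{|A|b)}_{~\alpha}=0$, and for each $\kappa\in b$ the field $C^{\Gamma0}_{A}$ has maximal rank (there is no $X_\Gamma\ne0$ with $X_\Gamma C^{\Gamma 0}_A=0$). (iii) The system may or may not admit extra Geroch fields $M^{\tilde\Delta a}_{A}(x,\phi)$, that is, fields with $M^{\tilde\Delta(a}_{A}\mathfrak{N}^{|A|b)}_{~\alpha}=0$ and $M^{\tilde\Delta a}_{A}\mathfrak{N}^{A0}_{~\alpha}=0$; if it does, then in every open $U\subset M$ and for all $\kappa=(x,\phi)\in b$ with $x\in U$ there is a finite family $M^{\tilde\Delta a}_A$, indexed by $\tilde\Delta$, such that any field satisfying these two equations is a linear combination of the $M^{\tilde\Delta a}_A$. (iv) The following integrability conditions hold identically (off-shell, i.e. for all fields $\phi$), for some $L^{\Gamma}_{1A}$, $L^{\tilde\Delta}_{2A}$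 depending on $(x,\phi,\nabla\phi)$: $$\nabla_d\big(C^{\Gamma d}_{A}E^{A}\big)=L^{\Gamma}_{1A}E^{A},\qquad \nabla_d\big(M^{\tilde\Delta d}_{\Gamma}C^{\Gamma0}_{A}E^{A}\big)=L^{\tilde\Delta}_{2A}E^{A}.$$ Let $h^{\alpha}_{A}$ be a reduction and $e^{\alpha}=h^{\alpha}_{A}E^{A}$ the corresponding evolution equations. Then the following off-shell identity is satisfied: $$\begin{aligned} &\nabla_0\psi^{\Gamma}+\big(C^{\Gamma i}_{A}h^{A}_{~\Delta}+N^{\Gamma}_{\tilde\Delta}M^{\tilde\Delta i}_{\Delta}\big)\nabla_i\psi^{\Delta}\\ &=\big(L^{\Gamma}_{1A}\mathfrak{N}^{A0}_{~\alpha}-\nabla_d(C^{\Gamma d}_{A}\mathfrak{N}^{A0}_{~\alpha})\big)e^{\alpha}-C^{\Gamma d}_{A}\mathfrak{N}^{A0}_{~\alpha}\nabla_d e^{\alpha}\\ &\quad+\Big(L^{\Gamma}_{1A}h^{A}_{~\Delta}-\nabla_d(C^{\Gamma d}_{A}h^{A}_{~\Delta})+N^{\Gamma}_{\tilde\Delta}\big(L^{\tilde\Delta}_{2A}h^{A}_{~\Delta}-\nabla_i(M^{\tilde\Delta i}_{\Delta})\big)\Big)\psi^{\Delta}, \end{aligned}$$ where $i=1,\dots,n$ and the fields $N^{\Gamma}_{\tilde\Delta}$ can be freely chosen. If the system does not admit Geroch fields $M^{\tilde\Delta a}_{A}$, then $N^{\Gamma}_{\tilde\Delta}=0$ and $L^{\tilde\Delta}_{2A}=0$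 (the corresponding terms are absent); in this case the subsidiary system below is unique. In the on-shell case, i.e. when $e^{\alpha}(\phi)=0$, the identity reduces to the subsidiary system $$\nabla_0\psi^{\Gamma}+\big(C^{\Gamma i}_{A}h^{A}_{~\Delta}+N^{\Gamma}_{\tilde\Delta}M^{\tilde\Delta i}_{\Delta}\big)\nabla_i\psi^{\Delta}=\Big(L^{\Gamma}_{1A}h^{A}_{~\Delta}-\nabla_d(C^{\Gamma d}_{A}h^{A}_{~\Delta})+N^{\Gamma}_{\tilde\Delta}\big(L^{\tilde\Delta}_{2A}h^{A}_{~\Delta}-\nabla_i(M^{\tilde\Delta i}_{\Delta})\big)\Big)\psi^{\Delta}.$$
   Context: Setting. $M$ is a space-time (manifold) of dimension $n+1$, $b\to M$ a fiber bundle, and the unknown is a cross-section $\phi^{\alpha}:M\to b$. Points of $b$ are written $\kappa=(x,\phi)$. Indices: $a,b,c,d,\dots$ are space-time indices; $\alpha,\beta,\dots$ are field indices with $u$ values; $A,B,\dots$ are equation indices with $e$ values, $e\ge u$; $\Gamma,\Delta,\dots$ take $c:=e-u$ values and number the constraints; $\tilde\Delta$ numbers the extra fields $M$. Repeated indices are summed; round brackets denote symmetrization of the two space-time indices (indices between bars are excluded). $\mathfrak{N}^{Aa}_{~\alpha}$ (principal symbol) and $J^A$ depend on $(x,\phi)$ but not on derivatives of $\phi$. $\nabla_a$ is a partial derivative, or a Levi-Civita connection when there is a metric. Foliation: $M$ is locally foliated by the level sets of a function $t$, with adapted coordinates $(t,x^i)$, $i=1,\dots,n$; $n_a:=\nabla_a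 t=(1,0,\dots,0)$, $t^a:=(\partial_t)^a=(1,0,\dots,0)$. An upper index $0$ means contraction with $n_a$, e.g. $\mathfrak{N}^{A0}_{~\alpha}:=\mathfrak{N}^{Aa}_{~\alpha}n_a$, $C^{\Gamma0}_A:=C^{\Gamma a}_An_a$; an upper index $i$ denotes the spatial components in these coordinates; $\nabla_0=t^a\nabla_a$. A Geroch field is a field $C^a_A(x,\phi)$ with $C^{(a}_A\mathfrak{N}^{|A|b)}_{~\alpha}=0$. Reduction: a field $h^{\alpha}_A(x,\phi)$ with $h^{\alpha}_A\mathfrak{N}^{A0}_{~\beta}=\delta^{\alpha}_{\beta}$. The evolution equations are $e^{\alpha}:=h^{\alpha}_AE^A=0$. Under (i) and (ii) the square matrix $\begin{bmatrix}h^{\alpha}_B\\ C^{\Delta0}_B\end{bmatrix}$ is invertible, with inverse of the form $\begin{bmatrix}\mathfrak{N}^{B0}_{~\beta}& h^{B}_{~\Gamma}\end{bmatrix}$; this defines $h^{B}_{~\Gamma}$, i.e. $C^{\Delta0}_Bh^B_{~\Gamma}=\delta^{\Delta}_{\Gamma}$ and $h^{\alpha}_Bh^{B}_{~\Gamma}=0$. For the extra Geroch fields one sets $M^{\tilde\Delta a}_{\Gamma}:=M^{\tilde\Delta a}_{A}h^{A}_{~\Gamma}$. Standing assumptions: the system has no algebraic constraints, i.e. there is no $X_A\neq0$ with $X_A\mathfrak{N}^{Aa}_{~\alpha}=0$; the objects $\mathfrak{N}^{Aa}_{~\alpha}, J^A, C^{\Gamma a}_A, M^{\tilde\Delta a}_A,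 h^{\alpha}_A,h^A_{~\Gamma}$ admit at least one derivative in any direction.
   Formalization: The off-shell identity fails for arbitrary L_2 in (iv): proved for a suitable L_2, and for any L_2 with the extra term N L_{2A} N^{A0}_α e^α; the on-shell system is as stated. Uniqueness means the principal part and the value of the right-hand side where e=0, as L_1 is not unique. *)

(* Defs.v *)
(* All definitions are in an adapted chart of the base: a space-time point is x = (t, x^1, ..., x^n) : 'rV[R]_n.+1, index ord0 being t
   and [lift ord0 i] the i-th spatial index.  The bundle b is, in a local
   trivialisation, an open set B of pairs (x, phi) with phi : 'rV[R]_u; the base
   M is the projection of B. *)
From HB Require Import structures.
From mathcomp Require Import all_boot all_order all_algebra.
From mathcomp Require Import all_classical all_reals all_analysis.

Set Implicit Arguments.
Unset Strict Implicit.
Unset Printing Implicit Defensive.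

Import Order.TTheory GRing.Theory Num.Theory.
Import numFieldNormedType.Exports.
Local Open Scope classical_set_scope.
Local Open Scope ring_scope.

Section Bundle.
Context {R : realType} {n u : nat}.

Definition scalar_on_bundle := 'rV[R]_n.+1 * 'rV[R]_u -> R.

(* Functions of (x, phi, d phi); the entry (a, alpha) of the matrix is the
   derivative of phi^alpha along x^a. *)
Definition scalar_on_jets := 'rV[R]_n.+1 -> 'rV[R]_u -> 'M[R]_(n.+1, u) -> R.

Definition base (B : set ('rV[R]_n.+1 * 'rV[R]_u)) : set 'rV[R]_n.+1 :=
  [set x | exists v, B (x, v)].

Definition over (B : set ('rV[R]_n.+1 * 'rV[R]_u)) (U : set 'rV[R]_n.+1) :
    set ('rV[R]_n.+1 * 'rV[R]_u) :=
  [set kappa | B kappa /\ U kappa.1].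

Definition differentiable_on (W : set ('rV[R]_n.+1 * 'rV[R]_u))
    (f : scalar_on_bundle) : Prop :=
  forall kappa, W kappa -> differentiable f kappa.

Definition pder (a : 'I_n.+1) (f : 'rV[R]_n.+1 -> R) (x : 'rV[R]_n.+1) : R :=
  'D_(delta_mx ord0 a) f x.

Definition conormal_t (a : 'I_n.+1) : R := (a == ord0)%:R.

Definition vector_t (a : 'I_n.+1) : R := (a == ord0)%:R.

Definition up0 (V : 'I_n.+1 -> R) : R := \sum_a V a * conormal_t a.

Definition der0 (f : 'rV[R]_n.+1 -> R) (x : 'rV[R]_n.+1) : R :=
  \sum_a vector_t a * pder a f x.

Definition component (phi : 'rV[R]_n.+1 -> 'rV[R]_u) (alpha : 'I_u) :
    'rV[R]_n.+1 -> R :=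
  fun x => phi x ord0 alpha.

Definition jet (phi : 'rV[R]_n.+1 -> 'rV[R]_u) (x : 'rV[R]_n.+1) :
    'M[R]_(n.+1, u) :=
  \matrix_(a, alpha) pder a (component phi alpha) x.

(* Local cross-sections of b over an open set U of the base, twice
   differentiable so that E^A can be differentiated once.  The values of phi
   outside U are irrelevant. *)
Definition section_on (B : set ('rV[R]_n.+1 * 'rV[R]_u)) (U : set 'rV[R]_n.+1)
    (phi : 'rV[R]_n.+1 -> 'rV[R]_u) : Prop :=
  open U /\
  forall x, U x ->
    [/\ B (x, phi x), differentiable phi x &
        forall a alpha, differentiable (pder a (component phi alpha)) x].

(* The derivation operator is either the partial derivative or the Levi-Civita
   connection of a pseudo-Riemannian metric; the metric may depend on phi. *)
Inductive derivation : Type :=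
| PartialDerivative
| LeviCivita of ('rV[R]_n.+1 * 'rV[R]_u -> 'M[R]_n.+1).

Definition metric_on (B : set ('rV[R]_n.+1 * 'rV[R]_u))
    (g : 'rV[R]_n.+1 * 'rV[R]_u -> 'M[R]_n.+1) : Prop :=
  forall kappa, B kappa ->
    [/\ (g kappa)^T = g kappa, g kappa \in unitmx &
        forall a b, differentiable (fun kappa' => g kappa' a b) kappa].

Definition derivation_on (B : set ('rV[R]_n.+1 * 'rV[R]_u)) (D : derivation) :
    Prop :=
  if D is LeviCivita g then metric_on B g else True.

Definition christoffel (g : 'rV[R]_n.+1 * 'rV[R]_u -> 'M[R]_n.+1)
    (phi : 'rV[R]_n.+1 -> 'rV[R]_u) (x : 'rV[R]_n.+1) (a b c : 'I_n.+1) : R :=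
  2^-1 * \sum_d invmx (g (x, phi x)) a d *
    (pder b (fun y => g (y, phi y) d c) x
     + pder c (fun y => g (y, phi y) d b) x
     - pder d (fun y => g (y, phi y) b c) x).

Definition connection (D : derivation) (phi : 'rV[R]_n.+1 -> 'rV[R]_u)
    (x : 'rV[R]_n.+1) (a b c : 'I_n.+1) : R :=
  if D is LeviCivita g then christoffel g phi x a b c else 0.

(* The component nabla_b V^a. *)
Definition nabla_vector (D : derivation) (phi : 'rV[R]_n.+1 -> 'rV[R]_u)
    (b : 'I_n.+1) (V : 'I_n.+1 -> 'rV[R]_n.+1 -> R) (a : 'I_n.+1)
    (x : 'rV[R]_n.+1) : R :=
  pder b (V a) x + \sum_c connection D phi x a b c * V c x.

Definition divergence (D : derivation) (phi : 'rV[R]_n.+1 -> 'rV[R]_u)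
    (V : 'I_n.+1 -> 'rV[R]_n.+1 -> R) (x : 'rV[R]_n.+1) : R :=
  \sum_d nabla_vector D phi d V d x.

(* The divergence nabla_i V^i of the vector field V^i (d/dx^i), i = 1, ..., n:
   the sum of the partial derivatives of V^i along x^i, plus the contraction of
   V^i with the trace of the connection. *)
Definition spatial_divergence (D : derivation) (phi : 'rV[R]_n.+1 -> 'rV[R]_u)
    (V : 'I_n.+1 -> 'rV[R]_n.+1 -> R) (x : 'rV[R]_n.+1) : R :=
  divergence D phi (fun a y => if a == ord0 then 0 else V a y) x.

End Bundle.

Arguments scalar_on_bundle : clear implicits.
Arguments scalar_on_jets : clear implicits.
Arguments derivation : clear implicits.

(* The system E^A = symbol A a alpha * nabla_a phi^alpha - source A. *)
Record quasilinear (R : realType) (n u e : nat) := Quasilinear {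
  symbol : 'I_e -> 'I_n.+1 -> 'I_u -> scalar_on_bundle R n u;
  source : 'I_e -> scalar_on_bundle R n u }.

(* Fields X^a_A on b, the space-time index coming first. *)
Definition flux_field (R : realType) (n u e : nat) :=
  'I_n.+1 -> 'I_e -> scalar_on_bundle R n u.

Section System.
Context {R : realType} {n u e : nat}.
Variables (B : set ('rV[R]_n.+1 * 'rV[R]_u)) (S : quasilinear R n u e).

Definition equation (A : 'I_e) (phi : 'rV[R]_n.+1 -> 'rV[R]_u)
    (x : 'rV[R]_n.+1) : R :=
  \sum_a \sum_alpha symbol S A a alpha (x, phi x)
                    * pder a (component phi alpha) x
  - source S A (x, phi x).

Definition symbol0 (A : 'I_e) (alpha : 'I_u) : scalar_on_bundle R n u :=
  fun kappa => up0 (fun a => symbol S A a alpha kappa).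

Definition flux0 (X : flux_field R n u e) (A : 'I_e) : scalar_on_bundle R n u :=
  fun kappa => up0 (fun a => X a A kappa).

Definition no_algebraic_constraint : Prop :=
  forall kappa, B kappa -> forall X : 'I_e -> R,
    (forall a alpha, \sum_A X A * symbol S A a alpha kappa = 0) ->
    forall A, X A = 0.

Definition symbol0_max_rank : Prop :=
  forall kappa, B kappa -> forall dphi : 'I_u -> R,
    (forall A, \sum_beta symbol0 A beta kappa * dphi beta = 0) ->
    forall beta, dphi beta = 0.

Definition geroch_at (X : flux_field R n u e) kappa : Prop :=
  forall a b alpha,
    2^-1 * (\sum_A X a A kappa * symbol S A b alpha kappa
            + \sum_A X b A kappa * symbol S A a alpha kappa) = 0.

Definition extra_geroch_at (X : flux_field R n u e) kappa : Prop :=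
  geroch_at X kappa /\
  forall a alpha, \sum_A X a A kappa * symbol0 A alpha kappa = 0.

(* A constraint at kappa is a combination X_A E^A without t-derivatives, that is
   with X_A symbol0^A = 0; the second conjunct says that all of them are
   combinations of the C^{Gamma 0}_A E^A. *)
Definition geroch_constraints (c : nat) (C : 'I_c -> flux_field R n u e) :
    Prop :=
  forall kappa, B kappa ->
    [/\ forall Gamma, geroch_at (C Gamma) kappa,
        forall X : 'I_e -> R,
          (forall alpha, \sum_A X A * symbol0 A alpha kappa = 0) ->
          exists w : 'I_c -> R,
            forall A, X A = \sum_Gamma w Gamma * flux0 (C Gamma) A kappa &
        forall X : 'I_c -> R,
          (forall A, \sum_Gamma X Gamma * flux0 (C Gamma) A kappa = 0) ->
          forall Gamma, X Gamma = 0].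

Definition extra_geroch_on (U : set 'rV[R]_n.+1) (X : flux_field R n u e) :
    Prop :=
  (forall a A, differentiable_on (over B U) (X a A)) /\
  forall kappa, over B U kappa -> extra_geroch_at X kappa.

(* The system admits no extra Geroch field but 0, even locally. *)
Definition no_extra_geroch : Prop :=
  forall U, open U -> U `<=` base B -> forall X, extra_geroch_on U X ->
    forall kappa, over B U kappa -> forall a A, X a A kappa = 0.

(* m = 0 is the case of a system without extra Geroch fields. *)
Definition extra_geroch_family (m : nat) (M : 'I_m -> flux_field R n u e) :
    Prop :=
  (forall kappa, B kappa -> forall D, extra_geroch_at (M D) kappa) /\
  forall U, open U -> U `<=` base B -> forall X, extra_geroch_on U X ->
    forall kappa, over B U kappa ->
      exists w : 'I_m -> R,
        forall a A, X a A kappa = \sum_D w D * M D a A kappa.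

Definition reduction (h : 'I_u -> 'I_e -> scalar_on_bundle R n u) : Prop :=
  forall kappa, B kappa -> forall alpha beta,
    \sum_A h alpha A kappa * symbol0 A beta kappa = (alpha == beta)%:R.

(* The remaining columns k^A_Gamma of the inverse of the square matrix with rows
   h^alpha_A and C^{Gamma 0}_A. *)
Definition inverse_columns (c : nat) (C : 'I_c -> flux_field R n u e)
    (h : 'I_u -> 'I_e -> scalar_on_bundle R n u)
    (k : 'I_e -> 'I_c -> scalar_on_bundle R n u) : Prop :=
  forall kappa, B kappa ->
    (forall Delta Gamma,
       \sum_A flux0 (C Delta) A kappa * k A Gamma kappa
       = (Delta == Gamma)%:R) /\
    (forall alpha Gamma, \sum_A h alpha A kappa * k A Gamma kappa = 0).

Definition psi (c : nat) (C : 'I_c -> flux_field R n u e) (Gamma : 'I_c)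
    (phi : 'rV[R]_n.+1 -> 'rV[R]_u) (x : 'rV[R]_n.+1) : R :=
  \sum_A flux0 (C Gamma) A (x, phi x) * equation A phi x.

Definition evolution (h : 'I_u -> 'I_e -> scalar_on_bundle R n u)
    (alpha : 'I_u) (phi : 'rV[R]_n.+1 -> 'rV[R]_u) (x : 'rV[R]_n.+1) : R :=
  \sum_A h alpha A (x, phi x) * equation A phi x.

Definition flux_reduced (c : nat) (k : 'I_e -> 'I_c -> scalar_on_bundle R n u)
    (M : flux_field R n u e) (a : 'I_n.+1) (Gamma : 'I_c) :
    scalar_on_bundle R n u :=
  fun kappa => \sum_A M a A kappa * k A Gamma kappa.

Section Identities.
Variables (D : derivation R n u) (c m : nat).
Variables (C : 'I_c -> flux_field R n u e) (M : 'I_m -> flux_field R n u e).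
Variables (h : 'I_u -> 'I_e -> scalar_on_bundle R n u).
Variables (k : 'I_e -> 'I_c -> scalar_on_bundle R n u).
Variables (L1 : 'I_c -> 'I_e -> scalar_on_jets R n u).
Variables (L2 : 'I_m -> 'I_e -> scalar_on_jets R n u).
Variables (N : 'I_c -> 'I_m -> scalar_on_bundle R n u).

Definition integrability_C : Prop :=
  forall U phi, section_on B U phi -> forall x, U x -> forall Gamma,
    divergence D phi
      (fun d y => \sum_A C Gamma d A (y, phi y) * equation A phi y) x
    = \sum_A L1 Gamma A x (phi x) (jet phi x) * equation A phi x.

Definition integrability_M : Prop :=
  forall U phi, section_on B U phi -> forall x, U x -> forall Dt,
    divergence D phi
      (fun d y => \sum_Gamma flux_reduced k (M Dt) d Gamma (y, phi y)
         * \sum_A flux0 (C Gamma) A (y, phi y) * equation A phi y) x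
    = \sum_A L2 Dt A x (phi x) (jet phi x) * equation A phi x.

Definition principal_coef (Gamma Delta : 'I_c) (i : 'I_n) :
    scalar_on_bundle R n u := fun kappa =>
  \sum_A C Gamma (lift ord0 i) A kappa * k A Delta kappa
  + \sum_Dt N Gamma Dt kappa * flux_reduced k (M Dt) (lift ord0 i) Delta kappa.

Definition constraint_coef (Gamma Delta : 'I_c)
    (phi : 'rV[R]_n.+1 -> 'rV[R]_u) (x : 'rV[R]_n.+1) : R :=
  \sum_A L1 Gamma A x (phi x) (jet phi x) * k A Delta (x, phi x)
  - divergence D phi
      (fun d y => \sum_A C Gamma d A (y, phi y) * k A Delta (y, phi y)) x
  + \sum_Dt N Gamma Dt (x, phi x) *
      (\sum_A L2 Dt A x (phi x) (jet phi x) * k A Delta (x, phi x)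
       - spatial_divergence D phi
           (fun a y => flux_reduced k (M Dt) a Delta (y, phi y)) x).

Definition subsidiary_lhs (Gamma : 'I_c) (phi : 'rV[R]_n.+1 -> 'rV[R]_u)
    (x : 'rV[R]_n.+1) : R :=
  der0 (psi C Gamma phi) x
  + \sum_(i < n) \sum_Delta principal_coef Gamma Delta i (x, phi x)
                            * pder (lift ord0 i) (psi C Delta phi) x.

Definition subsidiary_rhs (Gamma : 'I_c) (phi : 'rV[R]_n.+1 -> 'rV[R]_u)
    (x : 'rV[R]_n.+1) : R :=
  \sum_Delta constraint_coef Gamma Delta phi x * psi C Delta phi x.

Definition evolution_terms (Gamma : 'I_c) (phi : 'rV[R]_n.+1 -> 'rV[R]_u)
    (x : 'rV[R]_n.+1) : R :=
  \sum_alpha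
    (\sum_A L1 Gamma A x (phi x) (jet phi x) * symbol0 A alpha (x, phi x)
     - divergence D phi
         (fun d y => \sum_A C Gamma d A (y, phi y) * symbol0 A alpha (y, phi y))
         x) * evolution h alpha phi x
  - \sum_alpha \sum_d
      (\sum_A C Gamma d A (x, phi x) * symbol0 A alpha (x, phi x))
      * pder d (evolution h alpha phi) x.

Definition offshell_identity : Prop :=
  forall U phi, section_on B U phi -> forall x, U x -> forall Gamma,
    subsidiary_lhs Gamma phi x
    = evolution_terms Gamma phi x + subsidiary_rhs Gamma phi x.

Definition onshell_system : Prop :=
  forall U phi, section_on B U phi ->
    (forall x, U x -> forall alpha, evolution h alpha phi x = 0) ->
    forall x, U x -> forall Gamma,
      subsidiary_lhs Gamma phi x = subsidiary_rhs Gamma phi x.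

(* The off-shell identity for an L2 that is not required to satisfy
   L2_A symbol0^A_alpha = 0: the last term is the e^alpha-part of
   N L2_A E^A, since E^A = symbol0^A_alpha e^alpha + k^A_Delta psi^Delta. *)
Definition offshell_identity_any_L2 : Prop :=
  forall U phi, section_on B U phi -> forall x, U x -> forall Gamma,
    subsidiary_lhs Gamma phi x
    = evolution_terms Gamma phi x + subsidiary_rhs Gamma phi x
      + \sum_Dt N Gamma Dt (x, phi x) * \sum_alpha
          (\sum_A L2 Dt A x (phi x) (jet phi x) * symbol0 A alpha (x, phi x))
          * evolution h alpha phi x.

End Identities.

(* P and Q are the coefficients of a first-order system for psi which holds
   modulo the evolution equations and their first derivatives. *)
Definition subsidiary_system (c : nat) (C : 'I_c -> flux_field R n u e)
    (h : 'I_u -> 'I_e -> scalar_on_bundle R n u)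
    (P : 'I_c -> 'I_c -> 'I_n -> scalar_on_bundle R n u)
    (Q : 'I_c -> 'I_c -> scalar_on_jets R n u) : Prop :=
  (forall Gamma Delta i, differentiable_on B (P Gamma Delta i)) /\
  exists (T : 'I_c -> 'I_u -> 'I_n.+1 -> scalar_on_bundle R n u)
         (K : 'I_c -> 'I_u -> scalar_on_jets R n u),
    (forall Gamma alpha d, differentiable_on B (T Gamma alpha d)) /\
    forall U phi, section_on B U phi -> forall x, U x -> forall Gamma,
      der0 (psi C Gamma phi) x
      + \sum_(i < n) \sum_Delta P Gamma Delta i (x, phi x)
                                * pder (lift ord0 i) (psi C Delta phi) x
      = \sum_alpha K Gamma alpha x (phi x) (jet phi x) * evolution h alpha phi x
        + \sum_alpha \sum_d T Gamma alpha d (x, phi x)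
                            * pder d (evolution h alpha phi) x
        + \sum_Delta Q Gamma Delta x (phi x) (jet phi x) * psi C Delta phi x.

(* Uniqueness of the subsidiary system with coefficients P0 and Q0 phi x: the
   principal part is unique, and so is the value of the right-hand side wherever
   the evolution equations hold.  The entries of Q themselves are not determined
   since Q may depend on psi through the derivatives of phi, so that
   Q^Gamma_Delta psi^Delta does not determine Q. *)
Definition unique_subsidiary_system (c : nat)
    (C : 'I_c -> flux_field R n u e)
    (h : 'I_u -> 'I_e -> scalar_on_bundle R n u)
    (P0 : 'I_c -> 'I_c -> 'I_n -> scalar_on_bundle R n u)
    (Q0 : 'I_c -> 'I_c -> ('rV[R]_n.+1 -> 'rV[R]_u) -> 'rV[R]_n.+1 -> R) :
    Prop :=
  forall P Q, subsidiary_system C h P Q ->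
    (forall kappa, B kappa -> forall Gamma Delta i,
       P Gamma Delta i kappa = P0 Gamma Delta i kappa) /\
    (forall U phi, section_on B U phi -> forall x, U x ->
       (forall alpha, evolution h alpha phi x = 0) -> forall Gamma,
       \sum_Delta Q Gamma Delta x (phi x) (jet phi x) * psi C Delta phi x
       = \sum_Delta Q0 Gamma Delta phi x * psi C Delta phi x).

End System.

(* Main.v *)
Require Import Defs.
From HB Require Import structures.
From mathcomp Require Import all_boot all_order all_algebra.
From mathcomp Require Import all_classical all_reals all_analysis.
From mathcomp Require Import ring lra.

Import Order.TTheory GRing.Theory Num.Theory.
Import numFieldNormedType.Exports.
Local Open Scope classical_set_scope.
Local Open Scope ring_scope.

(** Write S0 for the time component of the principal symbol and C0 for that of
    the Geroch fields.  Since h S0 = 1, C0 k = 1, h k = 0 and C0 S0 = 0 (the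
    time-time component of the Geroch condition), S0 h + k C0 is the identity
    of the equation indices ([resolution_identity]), whence
      E = S0 e + k psi.
    Substituting this into div (C E) = L1 E and into div (M psi) = L2 E and
    applying the Leibniz rule gives the identity ([offshell_any_L2]).  The time
    derivative of psi enters with coefficient C0 k = 1, that of e with
    C0 S0 = 0, and div (M psi) contains no time derivative at all: an extra
    Geroch field satisfies X^0_A N^{Ab} = 0 for every b, so X^0 = 0 because
    there are no algebraic constraints ([extra_geroch_time]).

    For an arbitrary L2 this leaves the term N (L2 S0) e.  It disappears for a
    well-chosen L2 ([adapted_L2]), which exists because L2 E = div (M psi)
    vanishes wherever psi does ([extra_source_vanishes]).  To see this, add
    (t - t0) w to the section: nothing changes on the slice t = t0 except the
    time derivative of phi, so neither psi nor its spatial derivatives change,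
    and neither does div (M psi) at a zero of psi, the connection being then
    multiplied by 0.  But e changes by w, so w can be chosen to make e, and
    hence E and L2 E, vanish.  An L2' proportional to psi C0 can then be
    rescaled to satisfy L2' E = L2 E, and L2' S0 = 0 since C0 S0 = 0.

    For uniqueness, compare a subsidiary system on two sections with the same
    1-jet at a point and different second derivatives there.  Its second-order
    part shows that the flux Z with components C0 in the time direction and
    P^i C0 in the spatial ones, minus T h, satisfies the Geroch condition
    ([second_order_flux_geroch]).  So does Z - C, whose time component is
    -T^0 h; contracting with S0 gives T^0 = 0, and Z - C is an extra Geroch
    field ([flux_defect_extra_geroch]).  Without such fields Z = C, and
    contraction with k and S0 yields P^i = C^i k and T = - C S0.  The remaining
    coefficients are compared by subtracting the two identities. *)

(** * Partial derivatives *)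

(** The difference of two functions with the same germ has differential 0, since
    it is a little-o of anything. *)
Lemma near_eq_differentiable (R : realFieldType) (V W : normedModType R)
    (f g : V -> W) (x : V) :
  (\near x, f x = g x) -> differentiable f x -> differentiable g x.
Proof.
move=> fg df; pose r := g - f.
have r0 : \forall y \near x, r y = 0.
  by apply: filterS fg => y fy; rewrite -[r y]/(g y - f y) fy subrr.
have rx : r x = 0 by exact: nbhs_singleton r0.
have ro : r \o shift x = cst (r x) + (0 : V -> W) +o_ 0 id.
  apply/eqaddoP => eps eps0.
  have : \forall y \near 0, r (y + x) = 0.
    by move: r0; rewrite (near_shift 0) subr0.
  apply: filterS => y /= ry.
  by rewrite !fctE /= ry rx addr0 subr0 normr0 mulr_ge0 ?normr_ge0 // ltW.
have dr : differentiable r x.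
  have c0 : continuous (\0 : {linear V -> W}) by move=> y; exact: cvg_cst.
  have E := diff_unique c0 ro.
  by apply/diff_locallyP; rewrite E.
have -> : g = f + r by rewrite /r addrC subrK.
exact: differentiableD.
Qed.

Section Calculus.
Context {R : realType} {n u : nat}.
Implicit Types (f g : 'rV[R]_n.+1 -> R) (x : 'rV[R]_n.+1) (a : 'I_n.+1).

Lemma pder_near a f g x : (\near x, f x = g x) -> pder a f x = pder a g x.
Proof. exact: near_eq_derive. Qed.

(** A spatial derivative at x only sees the slice t = t(x): it is insensitive to
    what happens off that slice. *)
Lemma pder_slice (i : 'I_n) f g x :
  (\forall y \near x, (y : 'rV[R]_n.+1) ord0 ord0 = x ord0 ord0 -> f y = g y) ->
  pder (lift ord0 i) f x = pder (lift ord0 i) g x.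
Proof.
move=> fg; rewrite /pder /derive; congr (lim _).
set e := delta_mx _ _.
have fgx : f x = g x by exact: (nbhs_singleton fg).
have fgh : \forall h \near (0 : R), f (h *: e + x) = g (h *: e + x).
  have c : (fun h : R => h *: e + x) @ 0 --> x.
    have : (fun h : R => h *: e + x) @ 0 --> (0 : R) *: e + x.
      apply: cvgD; last exact: cvg_cst.
      exact: scalel_continuous.
    by rewrite scale0r add0r.
  have : \forall h \near (0 : R), (h *: e + x) ord0 ord0 = x ord0 ord0 ->
      f (h *: e + x) = g (h *: e + x) by exact: (c _ fg).
  apply: filterS => h; apply.
  by rewrite !mxE eqxx /= mulr0 add0r.
have fgq : \forall h \near (0 : R),
    h^-1 *: ((f \o shift x) (h *: e) - f x)
    = h^-1 *: ((g \o shift x) (h *: e) - g x).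
  by apply: filterS fgh => h /= ->; rewrite fgx.
rewrite eqEsubset; split; apply/near_eq_cvg/cvg_within => //.
by apply: filterS fgq => h ->.
Qed.

Lemma pderD a f g x : differentiable f x -> differentiable g x ->
  pder a (fun y => f y + g y) x = pder a f x + pder a g x.
Proof. by move=> df dg; apply: deriveD; exact: diff_derivable. Qed.

Lemma pderM a f g x : differentiable f x -> differentiable g x ->
  pder a (fun y => f y * g y) x = pder a f x * g x + f x * pder a g x.
Proof.
move=> df dg; rewrite /pder.
have -> : (fun y => f y * g y) = f * g by [].
rewrite deriveM; try exact: diff_derivable.
by rewrite addrC; congr (_ + _); exact: mulrC.
Qed.

Lemma differentiable_fsum m (F : 'I_m -> 'rV[R]_n.+1 -> R) x :
  (forall i, differentiable (F i) x) ->
  differentiable (fun y => \sum_i F i y) x.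
Proof.
move=> dF; have -> : (fun y => \sum_i F i y) = \sum_i F i.
  by apply/funext => y; rewrite fct_sumE.
exact: differentiable_sum.
Qed.

Lemma pder_sum m a (F : 'I_m -> 'rV[R]_n.+1 -> R) x :
  (forall i, differentiable (F i) x) ->
  pder a (fun y => \sum_i F i y) x = \sum_i pder a (F i) x.
Proof.
move=> dF; have -> : (fun y => \sum_i F i y) = \sum_i F i.
  by apply/funext => y; rewrite fct_sumE.
by apply: derive_sum => i; exact: diff_derivable.
Qed.

Lemma differentiable_component (phi : 'rV[R]_n.+1 -> 'rV[R]_u) alpha x :
  differentiable phi x -> differentiable (component phi alpha) x.
Proof.
move=> dphi; apply: (@differentiable_comp _ _ _ _ phi (fun v => v ord0 alpha)) => //.
exact: differentiable_coord.
Qed.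

Lemma differentiable_pull (f : scalar_on_bundle R n u)
    (phi : 'rV[R]_n.+1 -> 'rV[R]_u) x :
  differentiable f (x, phi x) -> differentiable phi x ->
  differentiable (fun y => f (y, phi y)) x.
Proof.
move=> df dphi; apply: (@differentiable_comp _ _ _ _ (fun y => (y, phi y)) f) => //.
exact: differentiable_pair.
Qed.

(** By the chain rule, a derivative of f along a section involves the section only
    through its 1-jet. *)
Lemma pder_pull_jet (f : scalar_on_bundle R n u)
    (phi phi' : 'rV[R]_n.+1 -> 'rV[R]_u) x a :
  differentiable f (x, phi x) -> differentiable phi x ->
  differentiable phi' x -> phi' x = phi x -> jet phi' x = jet phi x ->
  pder a (fun y => f (y, phi' y)) x = pder a (fun y => f (y, phi y)) x.
Proof.
move=> df dphi dphi' ex ej.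
have chain (p : 'rV[R]_n.+1 -> 'rV[R]_u) : differentiable f (x, p x) ->
    differentiable p x ->
    pder a (fun y => f (y, p y)) x
    = 'd f (x, p x) (delta_mx ord0 a, \row_alpha jet p x a alpha).
  move=> dfp dp; rewrite /pder deriveE; last exact: differentiable_pull.
  have dpr : differentiable (fun y => (y, p y)) x by exact: differentiable_pair.
  rewrite [LHS](_ : _ = 'd (f \o (fun y => (y, p y))) x (delta_mx ord0 a))//.
  rewrite diff_comp //= diff_pair //=.
  congr ('d f _ (_, _)); first by rewrite diff_val.
  rewrite -deriveE // derive_mx; last exact: diff_derivable.
  by apply/rowP => alpha; rewrite !mxE.
by rewrite !chain // ?ex // ej.
Qed.

End Calculus.

(** * Divergences *)

Lemma up0E (R : realType) (n : nat) (V : 'I_n.+1 -> R) : up0 V = V ord0.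
Proof.
rewrite /up0 (bigD1 ord0) //= /conormal_t eqxx mulr1 big1 ?addr0 // => a.
by move=> /negbTE ->; rewrite mulr0.
Qed.

Lemma der0E (R : realType) (n : nat) (f : 'rV[R]_n.+1 -> R) x :
  der0 f x = pder ord0 f x.
Proof.
rewrite /der0 (bigD1 ord0) //= /vector_t eqxx mul1r big1 ?addr0 // => a.
by move=> /negbTE ->; rewrite mul0r.
Qed.

Section Divergence.
Context {R : realType} {n u : nat}.
Variables (D : derivation R n u) (phi : 'rV[R]_n.+1 -> 'rV[R]_u).
Variable x : 'rV[R]_n.+1.
Implicit Types V W : 'I_n.+1 -> 'rV[R]_n.+1 -> R.

(** The only trace of the connection that a divergence sees. *)
Definition connection_trace (c : 'I_n.+1) : R :=
  \sum_d connection D phi x d d c.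

Lemma divergenceE V :
  divergence D phi V x
  = \sum_d (pder d (V d) x + connection_trace d * V d x).
Proof.
rewrite /divergence /nabla_vector !big_split /=; congr (_ + _).
rewrite exchange_big /=; apply: eq_bigr => c _.
by rewrite /connection_trace mulr_suml.
Qed.

Lemma divergence_near V W :
  (forall d, \near x, V d x = W d x) ->
  divergence D phi V x = divergence D phi W x.
Proof.
move=> VW; rewrite !divergenceE; apply: eq_bigr => d _.
by rewrite (pder_near d _ _ _ (VW d)) (nbhs_singleton (VW d)).
Qed.

Lemma divergenceD V W :
  (forall d, differentiable (V d) x) -> (forall d, differentiable (W d) x) ->
  divergence D phi (fun d y => V d y + W d y) x
  = divergence D phi V x + divergence D phi W x.
Proof.
move=> dV dW; rewrite !divergenceE -big_split; apply: eq_bigr => d _ /=.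
by rewrite pderD // mulrDr addrACA.
Qed.

Lemma divergence_sumM m (V : 'I_m -> 'I_n.+1 -> 'rV[R]_n.+1 -> R)
    (f : 'I_m -> 'rV[R]_n.+1 -> R) :
  (forall j d, differentiable (V j d) x) -> (forall j, differentiable (f j) x) ->
  divergence D phi (fun d y => \sum_j V j d y * f j y) x
  = \sum_j (divergence D phi (V j) x * f j x)
    + \sum_d \sum_j V j d x * pder d (f j) x.
Proof.
move=> dV df; rewrite divergenceE.
under [X in _ = X + _]eq_bigr do rewrite divergenceE mulr_suml.
rewrite exchange_big -big_split; apply: eq_bigr => d _ /=.
rewrite pder_sum; last by move=> j; exact: differentiableM.
rewrite mulr_sumr -!big_split; apply: eq_bigr => j _ /=.
by rewrite pderM // mulrDl mulrA addrAC.
Qed.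

End Divergence.

(** * Geroch fields and reductions at a point of the bundle *)

Lemma sum_kronecker {R : pzSemiRingType} {I : finType} (i : I) (f : I -> R) :
  \sum_j (j == i)%:R * f j = f i.
Proof.
rewrite (bigD1 i) //= eqxx mul1r big1 ?addr0 // => j /negbTE ->.
exact: mul0r.
Qed.

Section PointwiseAlgebra.
Context {R : realType} {n u e c : nat}.
Variables (B : set ('rV[R]_n.+1 * 'rV[R]_u)) (S : quasilinear R n u e).
Variable kappa : 'rV[R]_n.+1 * 'rV[R]_u.
Implicit Types X : flux_field R n u e.

Lemma symbol0E A alpha : symbol0 S A alpha kappa = symbol S A ord0 alpha kappa.
Proof. exact: up0E. Qed.

Lemma flux0E X A : flux0 X A kappa = X ord0 A kappa.
Proof. exact: up0E. Qed.

Lemma geroch_swap X a b alpha : geroch_at S X kappa ->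
  \sum_A X a A kappa * symbol S A b alpha kappa
  = - \sum_A X b A kappa * symbol S A a alpha kappa.
Proof.
move=> /(_ a b alpha) /eqP; rewrite mulf_eq0 invr_eq0 pnatr_eq0 /=.
by rewrite addr_eq0 => /eqP.
Qed.

Lemma geroch_time_symbol0 X alpha : geroch_at S X kappa ->
  \sum_A X ord0 A kappa * symbol0 S A alpha kappa = 0.
Proof.
move=> gX; have /eqP := geroch_swap X ord0 ord0 alpha gX.
rewrite -addr_eq0 -mulr2n mulrn_eq0 /= => /eqP H; rewrite -[RHS]H.
by apply: eq_bigr => A _; rewrite symbol0E.
Qed.

(** The two conditions on an extra Geroch field give X^0_A N^{Ab} = - X^b_A N^{A0}
    = 0 for every b, which makes X^0 an algebraic constraint. *)
Lemma extra_geroch_time X A : no_algebraic_constraint B S -> B kappa ->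
  extra_geroch_at S X kappa -> X ord0 A kappa = 0.
Proof.
move=> no_alg Bk [gX X0]; apply: (no_alg kappa Bk (fun A => X ord0 A kappa)).
move=> a alpha; rewrite geroch_swap //.
under eq_bigr do rewrite -symbol0E.
by rewrite X0 oppr0.
Qed.

Variables (C : 'I_c -> flux_field R n u e).
Variables (h : 'I_u -> 'I_e -> scalar_on_bundle R n u).
Variables (k : 'I_e -> 'I_c -> scalar_on_bundle R n u).

(** For fixed A, the covector delta_A - (S0 h)_A annihilates S0, hence is a
    combination of the C0^Gamma; contracting it with k identifies the
    coefficients as k^A_Gamma.  Completeness of the constraints thus replaces a
    count of dimensions. *)
Lemma resolution_identity : B kappa -> geroch_constraints B S C ->
  reduction B S h -> inverse_columns B C h k -> forall A A',
  (A' == A)%:R = \sum_alpha symbol0 S A alpha kappa * h alpha A' kappa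
               + \sum_Gamma k A Gamma kappa * flux0 (C Gamma) A' kappa.
Proof.
move=> Bk /(_ _ Bk)[gC span _] /(_ _ Bk) red /(_ _ Bk)[Ck hk] A A'.
pose X A' := (A' == A)%:R
             - \sum_alpha symbol0 S A alpha kappa * h alpha A' kappa.
have Xf (f : 'I_e -> R) : \sum_A' X A' * f A'
    = f A - \sum_alpha symbol0 S A alpha kappa
              * \sum_A' h alpha A' kappa * f A'.
  under eq_bigr do rewrite /X mulrBl mulr_suml.
  rewrite sumrB sum_kronecker exchange_big; congr (_ - _).
  apply: eq_bigr => alpha _; rewrite mulr_sumr.
  by apply: eq_bigr => A'' _; rewrite mulrA.
have X0 beta : \sum_A' X A' * symbol0 S A' beta kappa = 0.
  rewrite Xf; under eq_bigr do rewrite red mulrC.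
  by rewrite sum_kronecker subrr.
have [w Xw] := span X X0.
have wk Gamma : w Gamma = k A Gamma kappa.
  transitivity (\sum_A' X A' * k A' Gamma kappa).
    under [RHS]eq_bigr do rewrite Xw mulr_suml.
    rewrite exchange_big -[LHS](sum_kronecker Gamma w).
    apply: eq_bigr => G _ /=; under [RHS]eq_bigr do rewrite -mulrA.
    by rewrite -mulr_sumr Ck mulrC.
  rewrite Xf big1 ?subr0 // => alpha _.
  by rewrite hk mulr0.
under [X in _ + X]eq_bigr do rewrite -wk.
by rewrite -Xw /X addrC subrK.
Qed.

End PointwiseAlgebra.

(** * The decomposition of the system and its divergences *)

Section Identities.
Context {R : realType} {n u e c : nat}.
Variables (B : set ('rV[R]_n.+1 * 'rV[R]_u)) (S : quasilinear R n u e).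
Hypothesis dsymbol : forall A a alpha, differentiable_on B (symbol S A a alpha).
Hypothesis dsource : forall A, differentiable_on B (source S A).
Implicit Types (phi : 'rV[R]_n.+1 -> 'rV[R]_u) (x : 'rV[R]_n.+1).

Lemma section_near {U phi x} : section_on B U phi -> U x ->
  \forall y \near x, U y /\ B (y, phi y).
Proof.
move=> [oU sec] Ux; have : \forall y \near x, U y by exact: open_nbhs_nbhs.
by apply: filterS => y Uy; split=> //; have [] := sec y Uy.
Qed.

Lemma differentiable_along (f : scalar_on_bundle R n u) {U phi x} :
  differentiable_on B f -> section_on B U phi -> U x ->
  differentiable (fun y => f (y, phi y)) x.
Proof.
move=> df [_ sec] Ux; have [Bx dphi _] := sec x Ux.
by apply: differentiable_pull => //; exact: df.
Qed.

Lemma differentiable_equation A {U phi x} : section_on B U phi -> U x ->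
  differentiable (equation S A phi) x.
Proof.
move=> sec Ux; have [_ _ d2] := sec.2 x Ux.
apply: differentiableB; last exact: (differentiable_along _ (dsource A) sec Ux).
apply: differentiable_fsum => a; apply: differentiable_fsum => alpha.
apply: differentiableM => //.
exact: (differentiable_along _ (dsymbol A a alpha) sec Ux).
Qed.

Lemma differentiable_combination (f : 'I_e -> scalar_on_bundle R n u)
    {U phi x} : (forall A, differentiable_on B (f A)) ->
  section_on B U phi -> U x ->
  differentiable (fun y => \sum_A f A (y, phi y) * equation S A phi y) x.
Proof.
move=> df sec Ux; apply: differentiable_fsum => A; apply: differentiableM.
  exact: (differentiable_along _ (df A) sec Ux).
exact: (differentiable_equation A sec Ux).
Qed.

Lemma differentiable_on_contraction m (f g : 'I_m -> scalar_on_bundle R n u) :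
  (forall j, differentiable_on B (f j)) ->
  (forall j, differentiable_on B (g j)) ->
  differentiable_on B (fun kappa => \sum_j f j kappa * g j kappa).
Proof.
move=> df dg kappa Bk.
have -> : (fun kappa => \sum_j f j kappa * g j kappa) = \sum_j (f j * g j).
  by apply/funext => y; rewrite fct_sumE.
apply: differentiable_sum => j.
by apply: differentiableM; [exact: df | exact: dg].
Qed.

Lemma differentiable_symbol0 A alpha : differentiable_on B (symbol0 S A alpha).
Proof.
rewrite (_ : symbol0 S A alpha = symbol S A ord0 alpha) //.
by apply/funext => kappa; exact: symbol0E.
Qed.

Lemma differentiable_flux0 (X : flux_field R n u e) A :
  (forall a A, differentiable_on B (X a A)) -> differentiable_on B (flux0 X A).
Proof.
by move=> dX; rewrite (_ : flux0 X A = X ord0 A) //; apply/funext => kappa;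
  exact: flux0E.
Qed.

Variables (C : 'I_c -> flux_field R n u e).
Variables (h : 'I_u -> 'I_e -> scalar_on_bundle R n u).
Variables (k : 'I_e -> 'I_c -> scalar_on_bundle R n u).
Hypothesis dC : forall Gamma a A, differentiable_on B (C Gamma a A).
Hypothesis dh : forall alpha A, differentiable_on B (h alpha A).
Hypothesis dk : forall A Gamma, differentiable_on B (k A Gamma).
Hypothesis constraints : geroch_constraints B S C.
Hypothesis red : reduction B S h.
Hypothesis inv : inverse_columns B C h k.

Lemma differentiable_psi Gamma {U phi x} : section_on B U phi -> U x ->
  differentiable (psi S C Gamma phi) x.
Proof.
by apply: differentiable_combination => A; exact: differentiable_flux0.
Qed.

Lemma differentiable_evolution alpha {U phi x} : section_on B U phi -> U x ->
  differentiable (evolution S h alpha phi) x.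
Proof. exact: differentiable_combination. Qed.

Lemma equation_decomposition A phi x : B (x, phi x) ->
  equation S A phi x
  = \sum_alpha symbol0 S A alpha (x, phi x) * evolution S h alpha phi x
    + \sum_Gamma k A Gamma (x, phi x) * psi S C Gamma phi x.
Proof.
move=> Bx; have res := resolution_identity B S _ C h k Bx constraints red inv A.
have -> : equation S A phi x
    = \sum_A' (A' == A)%:R * equation S A' phi x.
  by rewrite sum_kronecker.
under eq_bigr do rewrite res mulrDl !mulr_suml.
rewrite big_split /= exchange_big [X in _ + X]exchange_big /=.
congr (_ + _); apply: eq_bigr => j _; rewrite mulr_sumr;
  by apply: eq_bigr => i _; rewrite mulrA.
Qed.

Lemma combination_decomposition (L : 'I_e -> R) phi x : B (x, phi x) ->
  \sum_A L A * equation S A phi x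
  = \sum_alpha (\sum_A L A * symbol0 S A alpha (x, phi x))
               * evolution S h alpha phi x
    + \sum_Gamma (\sum_A L A * k A Gamma (x, phi x)) * psi S C Gamma phi x.
Proof.
move=> Bx; under eq_bigr do rewrite equation_decomposition // mulrDr !mulr_sumr.
rewrite big_split /= exchange_big [X in _ + X]exchange_big /=.
congr (_ + _); apply: eq_bigr => j _; rewrite mulr_suml;
  by apply: eq_bigr => i _; rewrite mulrA.
Qed.

Variable D : derivation R n u.

(** The Leibniz rule for E = S0 e + k psi.  In the time direction C0 k = 1 isolates
    the time derivative of psi^Gamma. *)
Lemma constraint_divergence Gamma {U phi x} : section_on B U phi -> U x ->
  divergence D phi
    (fun d y => \sum_A C Gamma d A (y, phi y) * equation S A phi y) x
  = \sum_alpha divergence D phi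
        (fun d y => \sum_A C Gamma d A (y, phi y) * symbol0 S A alpha (y, phi y))
        x * evolution S h alpha phi x
    + \sum_alpha \sum_d
        (\sum_A C Gamma d A (x, phi x) * symbol0 S A alpha (x, phi x))
        * pder d (evolution S h alpha phi) x
    + (\sum_Delta divergence D phi
          (fun d y => \sum_A C Gamma d A (y, phi y) * k A Delta (y, phi y)) x
          * psi S C Delta phi x
       + (der0 (psi S C Gamma phi) x
          + \sum_(i < n) \sum_Delta
              (\sum_A C Gamma (lift ord0 i) A (x, phi x) * k A Delta (x, phi x))
              * pder (lift ord0 i) (psi S C Delta phi) x)).
Proof.
move=> sec Ux; have [Bx _ _] := sec.2 x Ux.
have dCS alpha d : differentiable (fun y =>
    \sum_A C Gamma d A (y, phi y) * symbol0 S A alpha (y, phi y)) x.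
  apply: (differentiable_along
    (fun kappa => \sum_A C Gamma d A kappa * symbol0 S A alpha kappa) _ sec Ux).
  by apply: differentiable_on_contraction => // A; exact: differentiable_symbol0.
have dCk Delta d : differentiable (fun y =>
    \sum_A C Gamma d A (y, phi y) * k A Delta (y, phi y)) x.
  apply: (differentiable_along
    (fun kappa => \sum_A C Gamma d A kappa * k A Delta kappa) _ sec Ux).
  exact: differentiable_on_contraction.
have de alpha := differentiable_evolution alpha sec Ux.
have dpsi Delta := differentiable_psi Delta sec Ux.
transitivity (divergence D phi (fun d y =>
    \sum_alpha (\sum_A C Gamma d A (y, phi y) * symbol0 S A alpha (y, phi y))
               * evolution S h alpha phi y
    + \sum_Delta (\sum_A C Gamma d A (y, phi y) * k A Delta (y, phi y))
               * psi S C Delta phi y) x).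
  apply: divergence_near => d; apply: filterS (section_near sec Ux) => y [_ By].
  exact: combination_decomposition.
rewrite divergenceD; first last.
- by move=> d; apply: differentiable_fsum => j; exact: differentiableM.
- by move=> d; apply: differentiable_fsum => j; exact: differentiableM.
rewrite !divergence_sumM //; congr (_ + _ + (_ + _)).
  by rewrite exchange_big.
rewrite big_ord_recl der0E; congr (_ + _).
rewrite (bigD1 Gamma) //= [X in _ + X]big1 => [|Delta nD].
  under eq_bigr do rewrite -flux0E.
  by rewrite (inv _ Bx).1 eqxx mul1r addr0.
under eq_bigr do rewrite -flux0E.
by rewrite (inv _ Bx).1 eq_sym (negbTE nD) mul0r.
Qed.

Hypothesis no_alg : no_algebraic_constraint B S.
Variable X : flux_field R n u e.
Hypothesis dX : forall a A, differentiable_on B (X a A).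
Hypothesis extraX : forall kappa, B kappa -> extra_geroch_at S X kappa.

Lemma flux_reduced_time Delta kappa : B kappa ->
  flux_reduced k X ord0 Delta kappa = 0.
Proof.
move=> Bk; rewrite /flux_reduced big1 // => A _.
by rewrite (extra_geroch_time B S) ?mul0r //; exact: extraX.
Qed.

Lemma differentiable_flux_reduced a Delta :
  differentiable_on B (flux_reduced k X a Delta).
Proof. exact: differentiable_on_contraction. Qed.

(** Since the time component of an extra Geroch field vanishes, its full divergence
    is a spatial one and no time derivative of psi occurs. *)
Lemma extra_divergence {U phi x} : section_on B U phi -> U x ->
  divergence D phi
    (fun d y => \sum_Delta flux_reduced k X d Delta (y, phi y)
                * psi S C Delta phi y) x
  = \sum_Delta spatial_divergence D phi
        (fun a y => flux_reduced k X a Delta (y, phi y)) x * psi S C Delta phi x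
    + \sum_(i < n) \sum_Delta flux_reduced k X (lift ord0 i) Delta (x, phi x)
        * pder (lift ord0 i) (psi S C Delta phi) x.
Proof.
move=> sec Ux; have [Bx _ _] := sec.2 x Ux.
have dM Delta d := differentiable_along _ (differentiable_flux_reduced d Delta)
  sec Ux.
have dpsi Delta := differentiable_psi Delta sec Ux.
rewrite divergence_sumM //; congr (_ + _).
  apply: eq_bigr => Delta _; congr (_ * _).
  apply: divergence_near => d; apply: filterS (section_near sec Ux) => y [_ By].
  by case: eqVneq => // ->; rewrite flux_reduced_time.
rewrite big_ord_recl [X in X + _]big1 ?add0r // => Delta _.
by rewrite flux_reduced_time // mul0r.
Qed.

End Identities.

(** * Perturbing a section at a point *)

Section Coordinates.
Context {R : realType} {n : nat}.
Variable x : 'rV[R]_n.+1.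

(** Products of these functions realise a basis of the symmetric second
    derivatives at x. *)
Definition centered (a : 'I_n.+1) (y : 'rV[R]_n.+1) : R := y ord0 a - x ord0 a.

Lemma centered_at a : centered a x = 0.
Proof. exact: subrr. Qed.

Lemma differentiable_centered a y : differentiable (centered a) y.
Proof.
apply: differentiableB; last exact: differentiable_cst.
exact: differentiable_coord.
Qed.

Lemma pder_centered a b : pder b (centered a) = cst (b == a)%:R.
Proof.
apply/funext => y; rewrite /pder deriveB; first last.
- exact: derivable_cst.
- by apply: diff_derivable; exact: differentiable_coord.
have := @derive_id R 'rV[R]_n.+1 y (delta_mx ord0 b).
rewrite derive_mx; last exact: derivable_id.
move=> /matrixP /(_ ord0 a); rewrite !mxE eqxx /= => ->.
by rewrite derive_cst subr0 eq_sym.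
Qed.

Lemma pder_centeredM a b c :
  pder c (fun y => centered a y * centered b y)
  = fun y => (c == a)%:R * centered b y + centered a y * (c == b)%:R.
Proof.
apply/funext => y; rewrite pderM; try exact: differentiable_centered.
by rewrite !pder_centered.
Qed.

Lemma differentiable_pder_centeredM a b c y :
  differentiable (pder c (fun y => centered a y * centered b y)) y.
Proof.
rewrite pder_centeredM; apply: differentiableD; apply: differentiableM;
  by [exact: differentiable_cst | exact: differentiable_centered].
Qed.

Lemma pder2_centeredM a b c d :
  pder d (pder c (fun y => centered a y * centered b y)) x
  = (c == a)%:R * (d == b)%:R + (c == b)%:R * (d == a)%:R.
Proof.
rewrite pder_centeredM pderD; first last.
- by apply: differentiableM; [exact: differentiable_centered|].
- by apply: differentiableM; [|exact: differentiable_centered].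
have dc z := differentiable_centered z x.
have cst0 (r : R) : pder d (fun=> r) x = 0 by exact: derive_cst.
rewrite !pderM //; try exact: differentiable_cst.
by rewrite !pder_centered /= !cst0 mul0r mulr0 add0r addr0 [X in _ + X]mulrC.
Qed.

End Coordinates.

Section Perturbation.
Context {R : realType} {n u e : nat}.
Variables (B : set ('rV[R]_n.+1 * 'rV[R]_u)) (S : quasilinear R n u e).
Hypothesis hB : open B.
Implicit Types (phi : 'rV[R]_n.+1 -> 'rV[R]_u) (x : 'rV[R]_n.+1).

Lemma open_graph_preimage phi (U : set 'rV[R]_n.+1) : open U ->
  (forall y, U y -> differentiable phi y) ->
  open (U `&` [set y | B (y, phi y)]).
Proof.
move=> oU dphi; rewrite openE => y [Uy By].
change (nbhs y (U `&` [set z | B (z, phi z)])).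
apply: filterI; first exact: open_nbhs_nbhs.
have cphi : {for y, continuous (fun z => (z, phi z))}.
  apply: differentiable_continuous; apply: differentiable_pair => //.
  exact: dphi.
by apply: cphi; exact: open_nbhs_nbhs.
Qed.

Section ByScalar.
Variables (s : 'rV[R]_n.+1 -> R) (w : 'rV[R]_u).
Hypothesis ds : forall y, differentiable s y.
Hypothesis d2s : forall a y, differentiable (pder a s) y.
Variables (U : set 'rV[R]_n.+1) (phi : 'rV[R]_n.+1 -> 'rV[R]_u).
Hypothesis sec : section_on B U phi.

Definition shifted : 'rV[R]_n.+1 -> 'rV[R]_u := fun y => phi y + s y *: w.

(** The shifted section may leave b, so its domain shrinks to the open set where it
    does not. *)
Definition shifted_domain : set 'rV[R]_n.+1 :=
  U `&` [set y | B (y, shifted y)].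

Lemma differentiable_shifted y : U y -> differentiable shifted y.
Proof.
move=> Uy; have [_ dphi _] := sec.2 y Uy.
apply: (@differentiableD _ _ _ phi (fun y => s y *: w)) => //.
exact: differentiableZl.
Qed.

Lemma pder_shifted a alpha y : U y ->
  pder a (component shifted alpha) y
  = pder a (component phi alpha) y + pder a s y * w ord0 alpha.
Proof.
move=> Uy; have [_ dphi _] := sec.2 y Uy.
have -> : component shifted alpha
    = fun y => component phi alpha y + s y * w ord0 alpha.
  by apply/funext => z; rewrite /component /shifted !mxE.
rewrite pderD; last 2 first.
- exact: differentiable_component.
- by apply: differentiableM => //; exact: differentiable_cst.
rewrite pderM //.
have -> : pder a (fun=> w ord0 alpha) y = 0 by exact: derive_cst.
by rewrite mulr0 addr0.
Qed.

(** [pder_shifted] holds on U only, hence the passage to germs for the second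
    derivatives. *)
Lemma shifted_section : section_on B shifted_domain shifted.
Proof.
split.
  apply: open_graph_preimage; first by case: sec.
  by move=> y Uy; exact: differentiable_shifted.
move=> x [Ux Bx]; split; [exact: Bx | exact: differentiable_shifted |].
move=> a alpha; have [_ dphi d2phi] := sec.2 x Ux.
apply: (@near_eq_differentiable _ _ _
  (fun y => pder a (component phi alpha) y + pder a s y * w ord0 alpha)).
  apply: filterS (section_near B sec Ux) => y [Uy _].
  by rewrite pder_shifted.
apply: differentiableD => //; apply: differentiableM => //.
Qed.

Lemma equation_shifted A y : U y -> s y = 0 ->
  equation S A shifted y
  = equation S A phi y
    + \sum_a \sum_alpha symbol S A a alpha (y, phi y)
                        * (pder a s y * w ord0 alpha).
Proof.
move=> Uy sy; have e0 : shifted y = phi y by rewrite /shifted sy scale0r addr0.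
rewrite /equation e0 addrAC -big_split /=; congr (_ - _).
apply: eq_bigr => a _; rewrite -big_split; apply: eq_bigr => alpha _ /=.
by rewrite pder_shifted // mulrDr.
Qed.

Lemma jet_shifted x : U x -> (forall a, pder a s x = 0) ->
  jet shifted x = jet phi x.
Proof.
move=> Ux s0; apply/matrixP => a alpha; rewrite !mxE pder_shifted // s0.
by rewrite mul0r addr0.
Qed.

Hypothesis dsymbol : forall A a alpha, differentiable_on B (symbol S A a alpha).
Hypothesis dsource : forall A, differentiable_on B (source S A).

(** When s and its first derivatives vanish at x, only the second derivatives of
    the section change there, and they enter through the principal symbol. *)
Lemma pder_combination_shifted (f : 'I_e -> scalar_on_bundle R n u) d x :
  (forall A, differentiable_on B (f A)) ->
  U x -> s x = 0 -> (forall a, pder a s x = 0) ->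
  pder d (fun y => \sum_A f A (y, shifted y) * equation S A shifted y) x
  = pder d (fun y => \sum_A f A (y, phi y) * equation S A phi y) x
    + \sum_A f A (x, phi x) *
        (\sum_a \sum_alpha symbol S A a alpha (x, phi x)
           * (pder d (pder a s) x * w ord0 alpha)).
Proof.
move=> df Ux sx s1; have [Bx dphi d2phi] := sec.2 x Ux.
have e0 : shifted x = phi x by rewrite /shifted sx scale0r addr0.
have sec' := shifted_section.
have Ux' : shifted_domain x by split=> //=; rewrite e0.
have ej := jet_shifted x Ux s1.
have same (g : scalar_on_bundle R n u) : differentiable_on B g ->
    pder d (fun y => g (y, shifted y)) x = pder d (fun y => g (y, phi y)) x.
  move=> dg; apply: pder_pull_jet e0 ej; [exact: dg | exact: dphi |].
  exact: differentiable_shifted.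
have eqE A : equation S A shifted x = equation S A phi x.
  rewrite equation_shifted // [X in _ + X]big1 ?addr0 // => a _.
  by rewrite big1 // => alpha _; rewrite s1 mul0r mulr0.
have dE A : pder d (equation S A shifted) x = pder d (equation S A phi) x
    + \sum_a \sum_alpha symbol S A a alpha (x, phi x)
           * (pder d (pder a s) x * w ord0 alpha).
  have expand (U' : set 'rV[R]_n.+1) (p : 'rV[R]_n.+1 -> 'rV[R]_u) :
      section_on B U' p -> U' x ->
      pder d (equation S A p) x
      = \sum_a \sum_alpha
          (pder d (fun y => symbol S A a alpha (y, p y)) x
             * pder a (component p alpha) x
           + symbol S A a alpha (x, p x)
             * pder d (pder a (component p alpha)) x)
        - pder d (fun y => source S A (y, p y)) x.
    move=> secp U'x; have [_ _ d2p] := secp.2 x U'x.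
    have dsy a alpha := differentiable_along B _ (dsymbol A a alpha) secp U'x.
    have dsp a alpha : differentiable (fun y => symbol S A a alpha (y, p y)
        * pder a (component p alpha) y) x by exact: differentiableM.
    rewrite [LHS]deriveB; last 2 first.
    - apply: diff_derivable; apply: differentiable_fsum => a.
      exact: differentiable_fsum.
    - apply: diff_derivable.
      exact: (differentiable_along B _ (dsource A) secp U'x).
    congr (_ - _); rewrite -/(pder d _ x) pder_sum; last first.
      by move=> a; exact: differentiable_fsum.
    apply: eq_bigr => a _; rewrite pder_sum //; apply: eq_bigr => alpha _.
    exact: pderM.
  rewrite (expand _ _ sec' Ux') (expand _ _ sec Ux).
  rewrite [RHS]addrAC; congr (_ - _); last exact: (same _ (dsource A)).
  rewrite -[RHS]big_split.
  apply: eq_bigr => a _; rewrite -big_split /=.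
  apply: eq_bigr => alpha _; rewrite (same _ (dsymbol A a alpha)) e0 pder_shifted // s1 mul0r addr0.
  rewrite -addrA -mulrDr; congr (_ + _ * _).
  transitivity (pder d (fun y => pder a (component phi alpha) y
                                 + pder a s y * w ord0 alpha) x).
    apply: pder_near; apply: filterS (section_near B sec Ux) => y [Uy _].
    exact: pder_shifted.
  rewrite pderD //; last first.
    by apply: differentiableM => //; exact: differentiable_cst.
  rewrite pderM //.
  have -> : pder d (fun=> w ord0 alpha) x = 0 by exact: derive_cst.
  by rewrite mulr0 addr0.
have expandC (U' : set 'rV[R]_n.+1) (p : 'rV[R]_n.+1 -> 'rV[R]_u) :
    section_on B U' p -> U' x ->
    pder d (fun y => \sum_A f A (y, p y) * equation S A p y) x
    = \sum_A (pder d (fun y => f A (y, p y)) x * equation S A p x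
              + f A (x, p x) * pder d (equation S A p) x).
  move=> secp U'x.
  have dfA A := differentiable_along B _ (df A) secp U'x.
  have dEA A := differentiable_equation B S dsymbol dsource A secp U'x.
  rewrite pder_sum; last by move=> A; exact: differentiableM.
  by apply: eq_bigr => A _; rewrite pderM.
rewrite (expandC _ _ sec' Ux') (expandC _ _ sec Ux) -big_split.
apply: eq_bigr => A _ /=.
by rewrite (same _ (df A)) eqE e0 dE (mulrDr (f A (x, phi x))) addrA.
Qed.

End ByScalar.
End Perturbation.

(** * The off-shell identity *)

Section Subsidiary.
Context {R : realType} {n u e c m : nat}.
Variables (B : set ('rV[R]_n.+1 * 'rV[R]_u)) (S : quasilinear R n u e).
Variables (D : derivation R n u).
Variables (C : 'I_c -> flux_field R n u e) (M : 'I_m -> flux_field R n u e).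
Variables (h : 'I_u -> 'I_e -> scalar_on_bundle R n u).
Variables (k : 'I_e -> 'I_c -> scalar_on_bundle R n u).
Variables (L1 : 'I_c -> 'I_e -> scalar_on_jets R n u).
Hypothesis dsymbol : forall A a alpha, differentiable_on B (symbol S A a alpha).
Hypothesis dsource : forall A, differentiable_on B (source S A).
Hypothesis dC : forall Gamma a A, differentiable_on B (C Gamma a A).
Hypothesis dM : forall Dt a A, differentiable_on B (M Dt a A).
Hypothesis dh : forall alpha A, differentiable_on B (h alpha A).
Hypothesis dk : forall A Gamma, differentiable_on B (k A Gamma).
Hypothesis no_alg : no_algebraic_constraint B S.
Hypothesis constraints : geroch_constraints B S C.
Hypothesis extra : forall kappa, B kappa -> forall Dt,
  extra_geroch_at S (M Dt) kappa.
Hypothesis red : reduction B S h.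
Hypothesis inv : inverse_columns B C h k.
Hypothesis int_C : integrability_C B S D C L1.

(** The identity for C comes from [constraint_divergence]; N times the one for M
    from [extra_divergence] is added to it. *)
Lemma offshell_any_L2 (L2 : 'I_m -> 'I_e -> scalar_on_jets R n u)
    (N : 'I_c -> 'I_m -> scalar_on_bundle R n u) :
  integrability_M B S D C M k L2 ->
  offshell_identity_any_L2 B S D C M h k L1 L2 N.
Proof.
move=> int_M U phi sec x Ux Gamma; have [Bx _ _] := sec.2 x Ux.
have eqC := int_C U phi sec x Ux Gamma.
rewrite (constraint_divergence B S dsymbol dsource C h k dC dh dk
  constraints red inv D Gamma sec Ux) in eqC.
rewrite (combination_decomposition B S C h k constraints red inv) // in eqC.
have eqM Dt := int_M U phi sec x Ux Dt.
have {}eqM Dt : \sum_(i < n) \sum_Delta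
      flux_reduced k (M Dt) (lift ord0 i) Delta (x, phi x)
      * pder (lift ord0 i) (psi S C Delta phi) x
    = \sum_alpha (\sum_A L2 Dt A x (phi x) (jet phi x)
                         * symbol0 S A alpha (x, phi x))
                 * evolution S h alpha phi x
      + \sum_Delta (\sum_A L2 Dt A x (phi x) (jet phi x) * k A Delta (x, phi x)
          - spatial_divergence D phi
              (fun a y => flux_reduced k (M Dt) a Delta (y, phi y)) x)
          * psi S C Delta phi x.
  have exM kappa : B kappa -> extra_geroch_at S (M Dt) kappa.
    by move=> Bk; exact: extra.
  have /= := extra_divergence B S dsymbol dsource C k dC dk D no_alg (M Dt)
    (dM Dt) exM sec Ux.
  rewrite [LHS]eqM (combination_decomposition B S C h k constraints red inv) //.
  move=> E; under [X in _ = _ + X]eq_bigr do rewrite mulrBl.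
  by rewrite sumrB addrA E addrAC subrr add0r.
rewrite /subsidiary_lhs /evolution_terms /subsidiary_rhs.
have -> : \sum_(i < n) \sum_Delta principal_coef C M k N Gamma Delta i (x, phi x)
      * pder (lift ord0 i) (psi S C Delta phi) x
    = \sum_(i < n) \sum_Delta
        (\sum_A C Gamma (lift ord0 i) A (x, phi x) * k A Delta (x, phi x))
        * pder (lift ord0 i) (psi S C Delta phi) x
      + \sum_Dt N Gamma Dt (x, phi x) * \sum_(i < n) \sum_Delta
          flux_reduced k (M Dt) (lift ord0 i) Delta (x, phi x)
          * pder (lift ord0 i) (psi S C Delta phi) x.
  under [X in _ = _ + X]eq_bigr do rewrite mulr_sumr.
  rewrite [X in _ = _ + X]exchange_big -big_split; apply: eq_bigr => i _ /=.
  under [X in _ = _ + X]eq_bigr do rewrite mulr_sumr.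
  rewrite [X in _ = _ + X]exchange_big -big_split; apply: eq_bigr => Delta _ /=.
  rewrite /principal_coef mulrDl; congr (_ + _); rewrite mulr_suml.
  by apply: eq_bigr => Dt _; rewrite mulrA.
have -> : \sum_Delta constraint_coef D C M k L1 L2 N Gamma Delta phi x
      * psi S C Delta phi x
    = \sum_Delta (\sum_A L1 Gamma A x (phi x) (jet phi x) * k A Delta (x, phi x))
        * psi S C Delta phi x
      - \sum_Delta divergence D phi
          (fun d y => \sum_A C Gamma d A (y, phi y) * k A Delta (y, phi y)) x
          * psi S C Delta phi x
      + \sum_Dt N Gamma Dt (x, phi x) * \sum_Delta
          (\sum_A L2 Dt A x (phi x) (jet phi x) * k A Delta (x, phi x)
           - spatial_divergence D phi
               (fun a y => flux_reduced k (M Dt) a Delta (y, phi y)) x)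
          * psi S C Delta phi x.
  under [X in _ = _ + X]eq_bigr do rewrite mulr_sumr.
  rewrite [X in _ = _ + X]exchange_big /= -sumrB -[RHS]big_split /=.
  apply: eq_bigr => Delta _ /=.
  rewrite /constraint_coef !mulrDl mulNr; congr (_ + _); rewrite mulr_suml.
  by apply: eq_bigr => Dt _; rewrite mulrA.
under [X in _ + (_ + X) = _]eq_bigr do rewrite eqM mulrDr.
rewrite [X in _ + (_ + X) = _]big_split /=.
under [X in _ = X - _ + _ + _]eq_bigr do rewrite mulrBl.
rewrite sumrB.
set psi0 := der0 _ _ in eqC *.
set a1 := \sum_(i < n) _ in eqC *.
set b1 := \sum_(i < u) _ in eqC *.
set b2 := \sum_(i < u) _ in eqC *.
set b3 := \sum_(i < c) _ in eqC *.
set a2 := \sum_(i < u) _ in eqC *.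
set a3 := \sum_(i < c) _ in eqC *.
set d1 := \sum_(i < m) _.
set d2 := \sum_(i < m) _.
have -> : psi0 = a2 + a3 - b1 - b2 - b3 - a1 by rewrite -eqC; ring.
by ring.
Qed.

End Subsidiary.

(** * The sources of the extra Geroch fields *)

Section SourceOfExtraGeroch.
Context {R : realType} {n u e c m : nat}.
Variables (B : set ('rV[R]_n.+1 * 'rV[R]_u)) (S : quasilinear R n u e).
Variables (D : derivation R n u).
Variables (C : 'I_c -> flux_field R n u e) (M : 'I_m -> flux_field R n u e).
Variables (h : 'I_u -> 'I_e -> scalar_on_bundle R n u).
Variables (k : 'I_e -> 'I_c -> scalar_on_bundle R n u).
Variables (L2 : 'I_m -> 'I_e -> scalar_on_jets R n u).
Hypothesis hB : open B.
Hypothesis no_alg : no_algebraic_constraint B S.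
Hypothesis constraints : geroch_constraints B S C.
Hypothesis extra : forall kappa, B kappa -> forall Dt,
  extra_geroch_at S (M Dt) kappa.
Hypothesis red : reduction B S h.
Hypothesis inv : inverse_columns B C h k.
Hypothesis int_M : integrability_M B S D C M k L2.

(** The section is shifted by (t - t(x)) w with w = - e(x).  This does not affect
    div (M psi) at x, as M^0 = 0 and psi(x) = 0, but it annihilates e and thus E
    at x, so that div (M psi) = L2 E = 0 for the shifted section. *)
Lemma extra_source_vanishes U phi x Dt : section_on B U phi -> U x ->
  (forall Gamma, psi S C Gamma phi x = 0) ->
  \sum_A L2 Dt A x (phi x) (jet phi x) * equation S A phi x = 0.
Proof.
move=> sec Ux psi0; have [Bx _ _] := sec.2 x Ux.
pose w : 'rV[R]_u := \row_alpha - evolution S h alpha phi x.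
pose s := centered x ord0.
have ds := differentiable_centered x ord0.
have pders a : pder a s = cst (a == ord0)%:R by exact: pder_centered.
have d2s a y : differentiable (pder a s) y.
  by rewrite pders; exact: differentiable_cst.
have sx : s x = 0 by exact: centered_at.
pose phi' := shifted s w phi.
have sec' : section_on B (shifted_domain B s w U phi) phi'.
  exact: shifted_section.
have same y : s y = 0 -> phi' y = phi y.
  by move=> sy; rewrite /phi' /shifted sy scale0r addr0.
have Ux' : shifted_domain B s w U phi x.
  by split=> //=; rewrite -/phi' same.
have eq' A y : U y -> s y = 0 -> equation S A phi' y
    = equation S A phi y
      + \sum_alpha symbol0 S A alpha (y, phi y) * w ord0 alpha.
  move=> Uy sy; rewrite /phi' (equation_shifted B S s w ds U phi sec A y Uy sy).
  congr (_ + _).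
  rewrite (bigD1 ord0) //= [X in _ + X]big1 ?addr0 => [|a /negbTE a0].
    by apply: eq_bigr => alpha _; rewrite pders /cst eqxx mul1r symbol0E.
  by apply: big1 => alpha _; rewrite pders /cst a0 mul0r mulr0.
have psi' Gamma y : U y -> s y = 0 -> psi S C Gamma phi' y = psi S C Gamma phi y.
  move=> Uy sy; have [By _ _] := sec.2 y Uy.
  have [gC _ _] := constraints (y, phi y) By.
  rewrite /psi; under eq_bigr do rewrite eq' // same // mulrDr mulr_sumr.
  rewrite big_split /= exchange_big [X in _ + X]big1 ?addr0 //= => alpha _.
  under eq_bigr do rewrite mulrA flux0E.
  by rewrite -mulr_suml (geroch_time_symbol0 S _ _ alpha (gC Gamma)) mul0r.
have ev' alpha : evolution S h alpha phi' x = 0.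
  rewrite /evolution; under eq_bigr do rewrite eq' // same // mulrDr mulr_sumr.
  rewrite big_split /= exchange_big /= [X in _ + X](bigD1 alpha) //=.
  rewrite [X in _ + (_ + X)]big1 => [|beta /negbTE ba].
    under [X in _ + (X + _)]eq_bigr do rewrite mulrA.
    by rewrite -mulr_suml red // eqxx mul1r mxE addr0 subrr.
  under eq_bigr do rewrite mulrA.
  by rewrite -mulr_suml red // eq_sym ba mul0r.
have eq0 A : equation S A phi' x = 0.
  rewrite (equation_decomposition B S C h k constraints red inv A phi' x);
    last by rewrite same.
  by rewrite !big1 ?addr0 // => j _; rewrite ?ev' ?psi' ?psi0 ?mulr0.
have z : \sum_A L2 Dt A x (phi' x) (jet phi' x) * equation S A phi' x = 0.
  by apply: big1 => A _; rewrite eq0 mulr0.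
rewrite -[RHS]z -[LHS](int_M _ _ sec x Ux) -[RHS](int_M _ _ sec' x Ux').
rewrite !divergenceE.
apply: eq_bigr => d _.
have flux_psi0 p : (forall Gamma, psi S C Gamma p x = 0) ->
    \sum_Gamma flux_reduced k (M Dt) d Gamma (x, p x)
      * \sum_A flux0 (C Gamma) A (x, p x) * equation S A p x = 0.
  move=> p0; apply: big1 => Gamma _.
  by rewrite -[X in _ * X]/(psi S C Gamma p x) p0 mulr0.
rewrite !flux_psi0 ?mulr0 ?addr0 //; last by move=> Gamma; rewrite psi'.
case: (unliftP ord0 d) => [i|] ->.
  apply: pder_slice; apply: filterS (section_near B sec Ux) => y [Uy _] y0.
  have sy : s y = 0 by rewrite /s /centered y0 subrr.
  apply: eq_bigr => Gamma _; rewrite same //; congr (_ * _).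
  by have := psi' Gamma y Uy sy; rewrite /psi same.
have time0 U' p : section_on B U' p -> U' x -> \forall y \near x,
    \sum_Gamma flux_reduced k (M Dt) ord0 Gamma (y, p y)
      * \sum_A flux0 (C Gamma) A (y, p y) * equation S A p y = 0.
  move=> secp U'x; apply: filterS (section_near B secp U'x) => y [_ By].
  apply: big1 => Gamma _; rewrite (flux_reduced_time B S k no_alg) ?mul0r //.
  by move=> kappa Bk; exact: extra.
by rewrite (pder_near _ _ _ _ (time0 _ _ sec Ux))
  (pder_near _ _ _ _ (time0 _ _ sec' Ux')).
Qed.

Definition equation_on_jets A : scalar_on_jets R n u := fun x v p =>
  \sum_a \sum_alpha symbol S A a alpha (x, v) * p a alpha - source S A (x, v).

Lemma equation_jet A phi x :
  equation S A phi x = equation_on_jets A x (phi x) (jet phi x).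
Proof.
rewrite /equation /equation_on_jets; congr (_ - _).
by apply: eq_bigr => a _; apply: eq_bigr => alpha _; rewrite mxE.
Qed.

Definition psi_on_jets Gamma : scalar_on_jets R n u := fun x v p =>
  \sum_A flux0 (C Gamma) A (x, v) * equation_on_jets A x v p.

Lemma psi_jet Gamma phi x :
  psi S C Gamma phi x = psi_on_jets Gamma x (phi x) (jet phi x).
Proof. by apply: eq_bigr => A _; rewrite equation_jet. Qed.

(** The field proportional to psi C0 that takes the same value on E as L2.  Where
    psi = 0 the quotient is 0 by convention, which is the right value there by
    [extra_source_vanishes]. *)
Definition adapted_L2 (Dt : 'I_m) (A : 'I_e) : scalar_on_jets R n u :=
  fun x v p =>
  (\sum_A' L2 Dt A' x v p * equation_on_jets A' x v p)
  / (\sum_Gamma psi_on_jets Gamma x v p ^+ 2)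
  * \sum_Gamma psi_on_jets Gamma x v p * flux0 (C Gamma) A (x, v).

Lemma adapted_L2_symbol0 Dt x v p alpha : B (x, v) ->
  \sum_A adapted_L2 Dt A x v p * symbol0 S A alpha (x, v) = 0.
Proof.
move=> Bx; have [gC _ _] := constraints _ Bx.
under eq_bigr do rewrite -mulrA.
rewrite -mulr_sumr; apply/eqP; rewrite mulf_eq0; apply/orP; right; apply/eqP.
under eq_bigr do rewrite mulr_suml.
rewrite exchange_big big1 //= => Gamma _.
under eq_bigr do rewrite -mulrA flux0E.
by rewrite -mulr_sumr geroch_time_symbol0 ?mulr0.
Qed.

Lemma adapted_L2_integrability : integrability_M B S D C M k adapted_L2.
Proof.
move=> U phi sec x Ux Dt; rewrite (int_M U phi sec x Ux Dt).
under [RHS]eq_bigr do rewrite -mulrA.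
rewrite -mulr_sumr.
under [X in _ = _ * X]eq_bigr do rewrite mulr_suml.
rewrite [X in _ = _ * X]exchange_big /=.
have -> : \sum_Gamma \sum_A psi_on_jets Gamma x (phi x) (jet phi x)
      * flux0 (C Gamma) A (x, phi x) * equation S A phi x
    = \sum_Gamma psi_on_jets Gamma x (phi x) (jet phi x) ^+ 2.
  apply: eq_bigr => Gamma _; under eq_bigr do rewrite -mulrA.
  by rewrite -mulr_sumr -[X in _ * X]/(psi S C Gamma phi x) psi_jet expr2.
under [X in _ = X / _ * _]eq_bigr do rewrite -equation_jet.
have [z|nz] := eqVneq (\sum_Gamma psi_on_jets Gamma x (phi x) (jet phi x) ^+ 2) 0.
  rewrite z mulr0; apply: extra_source_vanishes sec Ux _ => Gamma.
  rewrite psi_jet; apply/eqP; rewrite -sqrf_eq0; apply/eqP.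
  by apply: (psumr_eq0P _ z) => // G _; exact: sqr_ge0.
by rewrite divfK.
Qed.

End SourceOfExtraGeroch.

(** * Uniqueness of the subsidiary system *)

Section Uniqueness.
Context {R : realType} {n u e c : nat}.
Variables (B : set ('rV[R]_n.+1 * 'rV[R]_u)) (S : quasilinear R n u e).
Variables (C : 'I_c -> flux_field R n u e).
Variables (h : 'I_u -> 'I_e -> scalar_on_bundle R n u).
Variables (k : 'I_e -> 'I_c -> scalar_on_bundle R n u).
Hypothesis hB : open B.
Hypothesis dsymbol : forall A a alpha, differentiable_on B (symbol S A a alpha).
Hypothesis dsource : forall A, differentiable_on B (source S A).
Hypothesis dC : forall Gamma a A, differentiable_on B (C Gamma a A).
Hypothesis dh : forall alpha A, differentiable_on B (h alpha A).
Hypothesis constraints : geroch_constraints B S C.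
Hypothesis red : reduction B S h.
Hypothesis inv : inverse_columns B C h k.

Variables (P : 'I_c -> 'I_c -> 'I_n -> scalar_on_bundle R n u).
Variables (Q : 'I_c -> 'I_c -> scalar_on_jets R n u).
Variables (T : 'I_c -> 'I_u -> 'I_n.+1 -> scalar_on_bundle R n u).
Variables (K : 'I_c -> 'I_u -> scalar_on_jets R n u).
Hypothesis dP : forall Gamma Delta i, differentiable_on B (P Gamma Delta i).
Hypothesis dT : forall Gamma alpha d, differentiable_on B (T Gamma alpha d).
Hypothesis system :
  forall U phi, section_on B U phi -> forall x, U x -> forall Gamma,
  der0 (psi S C Gamma phi) x
  + \sum_(i < n) \sum_Delta P Gamma Delta i (x, phi x)
                            * pder (lift ord0 i) (psi S C Delta phi) x
  = \sum_alpha K Gamma alpha x (phi x) (jet phi x) * evolution S h alpha phi x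
    + \sum_alpha \sum_d T Gamma alpha d (x, phi x)
                        * pder d (evolution S h alpha phi) x
    + \sum_Delta Q Gamma Delta x (phi x) (jet phi x) * psi S C Delta phi x.

(** The flux through which the derivatives of psi in a subsidiary system with
    principal part P act on E: C0 in the time direction, P^i C0 in the spatial
    ones. *)
Definition psi_flux Gamma : flux_field R n u e := fun d A kappa =>
  if unlift ord0 d is Some i
  then \sum_Delta P Gamma Delta i kappa * flux0 (C Delta) A kappa
  else flux0 (C Gamma) A kappa.

Definition evolution_flux Gamma : flux_field R n u e := fun d A kappa =>
  \sum_alpha T Gamma alpha d kappa * h alpha A kappa.

Definition second_order_flux Gamma : flux_field R n u e := fun d A kappa =>
  psi_flux Gamma d A kappa - evolution_flux Gamma d A kappa.

(** G d A stands for the change of the derivative of E^A along x^d under a change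
    of the second derivatives of the section alone. *)
Lemma second_order_balance Gamma kappa (G : 'I_n.+1 -> 'I_e -> R) :
  \sum_A flux0 (C Gamma) A kappa * G ord0 A
  + \sum_(i < n) \sum_Delta P Gamma Delta i kappa
      * \sum_A flux0 (C Delta) A kappa * G (lift ord0 i) A
  - \sum_alpha \sum_d T Gamma alpha d kappa
      * \sum_A h alpha A kappa * G d A
  = \sum_d \sum_A second_order_flux Gamma d A kappa * G d A.
Proof.
under [RHS]eq_bigr do under eq_bigr do rewrite mulrBl.
under [RHS]eq_bigr do rewrite sumrB.
rewrite sumrB; congr (_ - _).
  rewrite [RHS]big_ord_recl; congr (_ + _).
    by apply: eq_bigr => A _; rewrite /psi_flux unlift_none.
  apply: eq_bigr => i _; under eq_bigr do rewrite mulr_sumr.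
  rewrite exchange_big; apply: eq_bigr => A _ /=.
  rewrite /psi_flux liftK mulr_suml.
  by apply: eq_bigr => Delta _; rewrite mulrA.
rewrite exchange_big; apply: eq_bigr => d _ /=.
under eq_bigr do rewrite mulr_sumr.
rewrite exchange_big; apply: eq_bigr => A _ /=.
by rewrite mulr_suml; apply: eq_bigr => alpha _; rewrite mulrA.
Qed.

(** The system is compared on a constant section and on its shift by the product of
    two centered coordinates, which have the same 1-jet at x: the terms in the
    second derivatives must cancel. *)
Lemma second_order_flux_geroch Gamma kappa : B kappa ->
  geroch_at S (second_order_flux Gamma) kappa.
Proof.
case: kappa => x v Bk a b beta.
pose U : set 'rV[R]_n.+1 := [set y | B (y, v)].
pose phi : 'rV[R]_n.+1 -> 'rV[R]_u := fun=> v.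
have sec : section_on B U phi.
  split.
    have := @open_graph_preimage R n u B hB phi setT openT.
    rewrite setTI; apply => y _; exact: differentiable_cst.
  move=> y Uy; split; [exact: Uy | exact: differentiable_cst | move=> d alpha].
  have -> : pder d (component phi alpha) = cst 0.
    by apply/funext => z; exact: derive_cst.
  exact: differentiable_cst.
have Ux : U x by [].
pose s : 'rV[R]_n.+1 -> R := fun y => centered x a y * centered x b y.
pose w : 'rV[R]_u := delta_mx ord0 beta.
have ds y : differentiable s y.
  by apply: differentiableM; exact: differentiable_centered.
have d2s d y : differentiable (pder d s) y.
  exact: differentiable_pder_centeredM.
have sx : s x = 0 by rewrite /s !centered_at mul0r.
have s1 d : pder d s x = 0.
  by rewrite /s pder_centeredM !centered_at mulr0 mul0r addr0.
pose phi' := shifted s w phi.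
have sec' : section_on B (shifted_domain B s w U phi) phi'.
  exact: shifted_section.
have ex : phi' x = phi x by rewrite /phi' /shifted sx scale0r addr0.
have Ux' : shifted_domain B s w U phi x by split=> //=; rewrite -/phi' ex.
have ej : jet phi' x = jet phi x.
  exact: (jet_shifted B s w ds U phi sec x Ux s1).
have eE A : equation S A phi' x = equation S A phi x.
  by rewrite !equation_jet ex ej.
have comb := pder_combination_shifted B S hB s w ds d2s U phi sec dsymbol
  dsource _ _ x _ Ux sx s1.
pose G d A := \sum_a0 \sum_alpha symbol S A a0 alpha (x, phi x)
           * (pder d (pder a0 s) x * w ord0 alpha).
have dpsi Delta d : pder d (psi S C Delta phi') x
    = pder d (psi S C Delta phi) x
      + \sum_A flux0 (C Delta) A (x, phi x) * G d A.
  by apply: comb => A; exact: differentiable_flux0.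
have dev alpha d : pder d (evolution S h alpha phi') x
    = pder d (evolution S h alpha phi) x
      + \sum_A h alpha A (x, phi x) * G d A.
  exact: comb.
have epsi Delta : psi S C Delta phi' x = psi S C Delta phi x.
  by apply: eq_bigr => A _; rewrite ex eE.
have eev alpha : evolution S h alpha phi' x = evolution S h alpha phi x.
  by apply: eq_bigr => A _; rewrite ex eE.
have balance : \sum_d \sum_A second_order_flux Gamma d A (x, v) * G d A = 0.
  rewrite -second_order_balance.
  have := system U phi sec x Ux Gamma.
  have := system _ phi' sec' x Ux' Gamma.
  rewrite !der0E dpsi ex ej.
  under [X in _ + X = _]eq_bigr do under eq_bigr do rewrite dpsi mulrDr.
  under [X in _ + X = _]eq_bigr do rewrite big_split.
  rewrite [X in _ + X = _]big_split /=.
  under [X in _ = X + _ + _]eq_bigr do rewrite eev.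
  under [X in _ = _ + _ + X]eq_bigr do rewrite epsi.
  under [X in _ = _ + X + _]eq_bigr do under eq_bigr do rewrite dev mulrDr.
  under [X in _ = _ + X + _]eq_bigr do rewrite big_split.
  rewrite [X in _ = _ + X + _]big_split /=.
  move: (\sum_(i < n) _) (\sum_(i < n) _) => p1 p2.
  move: (\sum_(alpha < u) \sum_d _) (\sum_(alpha < u) \sum_d _) => t1 t2.
  move: (\sum_(alpha < u) _) (\sum_(Delta < c) _) (pder _ _ _) => f q d0.
  move: (\sum_(A < e) _) => g.
  lra.
have GE d A : G d A = (d == a)%:R * symbol S A b beta (x, v)
    + (d == b)%:R * symbol S A a beta (x, v).
  have col a0 : \sum_alpha symbol S A a0 alpha (x, phi x)
      * (pder d (pder a0 s) x * w ord0 alpha)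
      = (a0 == a)%:R * ((d == b)%:R * symbol S A a0 beta (x, v))
        + (a0 == b)%:R * ((d == a)%:R * symbol S A a0 beta (x, v)).
    rewrite -(sum_kronecker beta (fun alpha => _ + _)).
    apply: eq_bigr => alpha _; rewrite mxE eqxx pder2_centeredM /=.
    case: (alpha =P beta) => [->|_]; last by rewrite mul0r !mulr0.
    by rewrite mul1r mulr1 mulrDr !mulrA ![_ * symbol _ _ _ _ _]mulrC !mulrA.
  rewrite /G; under eq_bigr do rewrite col.
  by rewrite big_split /= !sum_kronecker addrC.
have -> : \sum_A second_order_flux Gamma a A (x, v) * symbol S A b beta (x, v)
    + \sum_A second_order_flux Gamma b A (x, v) * symbol S A a beta (x, v)
    = \sum_d \sum_A second_order_flux Gamma d A (x, v) * G d A.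
  rewrite -[X in X + _](sum_kronecker a (fun d => \sum_A
    second_order_flux Gamma d A (x, v) * symbol S A b beta (x, v))).
  rewrite -[X in _ + X](sum_kronecker b (fun d => \sum_A
    second_order_flux Gamma d A (x, v) * symbol S A a beta (x, v))).
  rewrite -big_split; apply: eq_bigr => d _ /=.
  rewrite !mulr_sumr -big_split; apply: eq_bigr => A _ /=.
  by rewrite GE mulrDr; congr (_ + _); exact: mulrCA.
by rewrite balance mulr0.
Qed.

Definition flux_defect Gamma : flux_field R n u e := fun d A kappa =>
  second_order_flux Gamma d A kappa - C Gamma d A kappa.

Lemma evolution_flux_symbol0 Gamma d beta kappa : B kappa ->
  \sum_A evolution_flux Gamma d A kappa * symbol0 S A beta kappa
  = T Gamma beta d kappa.
Proof.
move=> Bk; under eq_bigr do rewrite mulr_suml.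
rewrite exchange_big -[RHS](sum_kronecker beta (fun b => T Gamma b d kappa)).
apply: eq_bigr => alpha _ /=; rewrite -(red _ Bk alpha beta) mulrC mulr_sumr.
by apply: eq_bigr => A _; rewrite mulrA.
Qed.

(** In the time direction the defect is - T^0 h.  Contracting with S0, where h S0 = 1,
    the time-time Geroch condition forces T^0 = 0. *)
Lemma flux_defect_time Gamma A kappa : B kappa ->
  geroch_at S (flux_defect Gamma) kappa -> flux_defect Gamma ord0 A kappa = 0.
Proof.
move=> Bk gX.
have defE A' : flux_defect Gamma ord0 A' kappa
    = - evolution_flux Gamma ord0 A' kappa.
  rewrite /flux_defect /second_order_flux /psi_flux unlift_none flux0E.
  by rewrite addrAC subrr add0r.
have T0 beta : T Gamma beta ord0 kappa = 0.
  rewrite -evolution_flux_symbol0 //; apply/eqP; rewrite -oppr_eq0 -sumrN.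
  apply/eqP; rewrite -[RHS](geroch_time_symbol0 S _ _ beta gX).
  by apply: eq_bigr => A' _; rewrite defE mulNr.
rewrite defE /evolution_flux big1 ?oppr0 // => alpha _.
by rewrite T0 mul0r.
Qed.

(** Given X^0 = 0, the Geroch condition in the directions (a, 0) reads
    X^a_A S0^A = 0, the second condition on an extra Geroch field. *)
Lemma flux_defect_extra_geroch Gamma :
  extra_geroch_on B S (base B) (flux_defect Gamma).
Proof.
split.
  move=> d A kappa [Bk _].
  have dh' : differentiable (fun kappa => evolution_flux Gamma d A kappa) kappa.
    exact: (differentiable_on_contraction B u (fun alpha => T Gamma alpha d)
      (fun alpha => h alpha A)).
  have dpsi : differentiable (fun kappa => psi_flux Gamma d A kappa) kappa.
    rewrite /psi_flux; case: (unlift ord0 d) => [i|].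
      apply: (differentiable_on_contraction B c (fun Delta => P Gamma Delta i)
        (fun Delta => flux0 (C Delta) A)) => // Delta.
      exact: differentiable_flux0.
    exact: differentiable_flux0 Bk.
  apply: differentiableB; last exact: dC.
  exact: differentiableB.
move=> kappa [Bk _]; have [gC _ _] := constraints _ Bk.
have gX : geroch_at S (flux_defect Gamma) kappa.
  move=> a b alpha.
  have := second_order_flux_geroch Gamma kappa Bk a b alpha.
  have := gC Gamma a b alpha.
  have split a' b' :
      \sum_A flux_defect Gamma a' A kappa * symbol S A b' alpha kappa
      = \sum_A second_order_flux Gamma a' A kappa * symbol S A b' alpha kappa
        - \sum_A C Gamma a' A kappa * symbol S A b' alpha kappa.
    by rewrite -sumrB; apply: eq_bigr => A _; rewrite mulrBl.
  by rewrite !split; lra.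
split=> // a alpha; under eq_bigr do rewrite symbol0E.
rewrite geroch_swap // big1 ?oppr0 // => A _.
by rewrite flux_defect_time ?mul0r.
Qed.

Lemma base_open : open (base B).
Proof.
rewrite openE => x [v Bxv].
have cx : {for x, continuous (fun y => (y, v))}.
  apply: differentiable_continuous; apply: differentiable_pair => //.
change (nbhs x (base B)).
have : \forall y \near x, B (y, v) by apply: cx; exact: open_nbhs_nbhs.
by apply: filterS => y By; exists v.
Qed.

Hypothesis no_extra : no_extra_geroch B S.

Lemma second_order_flux_unique Gamma d A kappa : B kappa ->
  second_order_flux Gamma d A kappa = C Gamma d A kappa.
Proof.
move=> Bk; apply/eqP; rewrite -subr_eq0; apply/eqP.
apply: (no_extra _ base_open _ _ (flux_defect_extra_geroch Gamma)) => //.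
by split=> //; exists kappa.2; case: (kappa) Bk.
Qed.

Lemma principal_coef_unique Gamma Delta i kappa : B kappa ->
  P Gamma Delta i kappa
  = \sum_A C Gamma (lift ord0 i) A kappa * k A Delta kappa.
Proof.
move=> Bk; have [Ck hk] := inv _ Bk.
under eq_bigr do rewrite -second_order_flux_unique // mulrBl.
rewrite sumrB /psi_flux liftK /evolution_flux.
under eq_bigr do rewrite mulr_suml.
under [X in _ = _ - X]eq_bigr do rewrite mulr_suml.
rewrite exchange_big [X in _ = _ - X]exchange_big /=.
rewrite [X in _ = _ - X]big1 ?subr0 => [|alpha _]; last first.
  by under eq_bigr do rewrite -mulrA; rewrite -mulr_sumr hk mulr0.
rewrite -[LHS](sum_kronecker Delta (fun G => P Gamma G i kappa)).
apply: eq_bigr => G _; under [RHS]eq_bigr do rewrite -mulrA.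
by rewrite -mulr_sumr Ck mulrC.
Qed.

Lemma evolution_coef_unique Gamma alpha d kappa : B kappa ->
  T Gamma alpha d kappa
  = - \sum_A C Gamma d A kappa * symbol0 S A alpha kappa.
Proof.
move=> Bk; have [gC _ _] := constraints _ Bk.
under eq_bigr do rewrite -second_order_flux_unique // mulrBl.
have flux0_symbol0 G : \sum_A flux0 (C G) A kappa * symbol0 S A alpha kappa = 0.
  by under eq_bigr do rewrite flux0E; exact: geroch_time_symbol0.
rewrite sumrB evolution_flux_symbol0 // [X in X - _](_ : _ = 0).
  by rewrite sub0r opprK.
rewrite /psi_flux; case: (unlift ord0 d) => [i|]; last exact: flux0_symbol0.
under eq_bigr do rewrite mulr_suml.
rewrite exchange_big big1 //= => G _; under eq_bigr do rewrite -mulrA.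
by rewrite -mulr_sumr flux0_symbol0 mulr0.
Qed.

End Uniqueness.

Theorem theorem8 (R : realType) (n u e : nat) (hue : (u <= e)%N)
    (B : set ('rV[R]_n.+1 * 'rV[R]_u)) (hB : open B)
    (D : derivation R n u) (hD : derivation_on B D)
    (S : quasilinear R n u e)
    (C : 'I_(e - u) -> flux_field R n u e)
    (m : nat) (M : 'I_m -> flux_field R n u e)
    (h : 'I_u -> 'I_e -> scalar_on_bundle R n u)
    (k : 'I_e -> 'I_(e - u) -> scalar_on_bundle R n u)
    (L1 : 'I_(e - u) -> 'I_e -> scalar_on_jets R n u)
    (L2 : 'I_m -> 'I_e -> scalar_on_jets R n u)
    (* standing assumptions *)
    (dsymbol : forall A a alpha, differentiable_on B (symbol S A a alpha))
    (dsource : forall A, differentiable_on B (source S A))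
    (dC : forall Gamma a A, differentiable_on B (C Gamma a A))
    (dM : forall Dt a A, differentiable_on B (M Dt a A))
    (dh : forall alpha A, differentiable_on B (h alpha A))
    (dk : forall A Gamma, differentiable_on B (k A Gamma))
    (no_alg : no_algebraic_constraint B S)
    (* (i), (ii), (iii) *)
    (rank : symbol0_max_rank B S)
    (constraints : geroch_constraints B S C)
    (extra : extra_geroch_family B S M)
    (* the reduction, and the fields h^A_Gamma it defines *)
    (red : reduction B S h)
    (inv : inverse_columns B C h k)
    (* (iv) *)
    (int_C : integrability_C B S D C L1)
    (int_M : integrability_M B S D C M k L2) :
  (* the off-shell identity, for a suitable L2 as in (iv) *)
  (exists L2' : 'I_m -> 'I_e -> scalar_on_jets R n u,
     integrability_M B S D C M k L2' /\
     forall N : 'I_(e - u) -> 'I_m -> scalar_on_bundle R n u,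
       offshell_identity B S D C M h k L1 L2' N) /\
  (* its form for the given L2 *)
  (forall N : 'I_(e - u) -> 'I_m -> scalar_on_bundle R n u,
     offshell_identity_any_L2 B S D C M h k L1 L2 N) /\
  (* the subsidiary system *)
  (forall N : 'I_(e - u) -> 'I_m -> scalar_on_bundle R n u,
     onshell_system B S D C M h k L1 L2 N) /\
  (* the case without extra Geroch fields *)
  (no_extra_geroch B S ->
     let L2_0 : 'I_m -> 'I_e -> scalar_on_jets R n u := fun _ _ _ _ _ => 0 in
     let N_0 : 'I_(e - u) -> 'I_m -> scalar_on_bundle R n u :=
       fun _ _ _ => 0 in
     [/\ offshell_identity B S D C M h k L1 L2_0 N_0,
         onshell_system B S D C M h k L1 L2_0 N_0 &
         unique_subsidiary_system B S C h
           (principal_coef C M k N_0)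
           (constraint_coef D C M k L1 L2_0 N_0)]).
Proof.
have [exM _] := extra.
have any_L2 L2' N : integrability_M B S D C M k L2' ->
    offshell_identity_any_L2 B S D C M h k L1 L2' N.
  exact: (offshell_any_L2 B S D C M h k L1 dsymbol dsource dC dM dh dk no_alg
    constraints exM red inv int_C).
split.
  exists (adapted_L2 S C L2).
  have int_M' := adapted_L2_integrability B S D C M h k L2 hB no_alg
    constraints exM red inv int_M.
  split=> // N U phi sec x Ux Gamma; have [Bx _ _] := sec.2 x Ux.
  rewrite (any_L2 _ N int_M' U phi sec x Ux Gamma).
  (* The term in N (L2 S0) e is killed by L2' S0 = 0. *)
  rewrite [X in _ + X = _]big1 ?addr0 // => Dt _.
  rewrite big1 ?mulr0 // => alpha _.
  by rewrite (adapted_L2_symbol0 B S C L2 constraints) ?mul0r.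
split; first by move=> N; exact: any_L2.
have onshell L2' N : integrability_M B S D C M k L2' ->
    onshell_system B S D C M h k L1 L2' N.
  move=> int_M' U phi sec ev0 x Ux Gamma.
  rewrite (any_L2 _ N int_M' U phi sec x Ux Gamma) /evolution_terms.
  (* The evolution equations hold on an open set, so e vanishes there together
     with its derivatives. *)
  have dev0 alpha d : pder d (evolution S h alpha phi) x = 0.
    rewrite (pder_near d _ (cst 0)); first exact: derive_cst.
    by apply: filterS (section_near B sec Ux) => y [Uy _]; rewrite ev0.
  rewrite !big1 ?subr0 ?add0r ?addr0 // => [Dt _|alpha _|alpha _].
  - by rewrite big1 ?mulr0 // => alpha _; rewrite ev0 // mulr0.
  - by rewrite big1 // => d _; rewrite dev0 mulr0.
  - by rewrite ev0 // mulr0.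
split; first by move=> N; exact: onshell.
move=> no_extra L2_0 N_0.
have rhs0 Gamma phi x : subsidiary_rhs S D C M k L1 L2_0 N_0 Gamma phi x
    = subsidiary_rhs S D C M k L1 L2 N_0 Gamma phi x.
  apply: eq_bigr => Delta _; congr ((_ + _) * _).
  by apply: eq_bigr => Dt _; rewrite !mul0r.
have offshell0 : offshell_identity B S D C M h k L1 L2_0 N_0.
  move=> U phi sec x Ux Gamma; rewrite rhs0.
  rewrite (any_L2 _ N_0 int_M U phi sec x Ux Gamma).
  by rewrite [X in _ + X = _]big1 ?addr0 // => Dt _; rewrite mul0r.
split=> //.
  move=> U phi sec ev0 x Ux Gamma; rewrite rhs0.
  exact: (onshell _ _ int_M U phi sec ev0 x Ux Gamma).
move=> P Q [dP [T [K [dT system]]]].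
have P0 kappa Gamma Delta i : B kappa ->
    P Gamma Delta i kappa = principal_coef C M k N_0 Gamma Delta i kappa.
  move=> Bk; rewrite /principal_coef [X in _ + X]big1 => [|Dt _].
    by rewrite addr0; apply: (principal_coef_unique B S C h k hB dsymbol dsource dC dh
      constraints red inv P Q T K dP dT system no_extra).
  by rewrite mul0r.
split=> [kappa Bk Gamma Delta i|U phi sec x Ux ev0 Gamma]; first exact: P0.
have [Bx _ _] := sec.2 x Ux.
have lhsE : \sum_(i < n) \sum_Delta P Gamma Delta i (x, phi x)
      * pder (lift ord0 i) (psi S C Delta phi) x
    = \sum_(i < n) \sum_Delta principal_coef C M k N_0 Gamma Delta i (x, phi x)
      * pder (lift ord0 i) (psi S C Delta phi) x.
  by apply: eq_bigr => i _; apply: eq_bigr => Delta _; rewrite P0.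
(* Only e is known to vanish at x, not its derivatives: their coefficients have
   to agree. *)
have TE : \sum_alpha \sum_d T Gamma alpha d (x, phi x)
      * pder d (evolution S h alpha phi) x
    = - \sum_alpha \sum_d
          (\sum_A C Gamma d A (x, phi x) * symbol0 S A alpha (x, phi x))
          * pder d (evolution S h alpha phi) x.
  rewrite -sumrN; apply: eq_bigr => alpha _; rewrite -sumrN.
  apply: eq_bigr => d _; rewrite -mulNr; congr (_ * _).
  by apply: (evolution_coef_unique B S C h hB dsymbol dsource dC dh
    constraints red P Q T K dP dT system no_extra).
have := system U phi sec x Ux Gamma; rewrite lhsE TE.
have := offshell0 U phi sec x Ux Gamma.
rewrite /subsidiary_lhs /evolution_terms => ->.
rewrite [X in X - _ + _ = _]big1 => [|alpha _]; last by rewrite ev0 mulr0.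
rewrite [X in _ = X - _ + _]big1 => [|alpha _]; last by rewrite ev0 mulr0.
by move/addrI => <-.
Qed.
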